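(* Let $\varphi$ be a complete Bernstein function (with zero killing and zero drift) satisfying (C) and (K) of the context; let $\mathcal M_-^{(\varphi)}$ be either $\mathcal M_-^{(\nu)}$ (assuming (A1)-(A2)) or $\mathcal M_-^{(\kappa)}$ (assuming (B1)-(B2)), and let $X_\varphi(1_{[0,t)}):=\langle\omega,\mathcal M_-^{(\varphi)}1_{[0,t)}\rangle$, $t\ge0$. Let $\theta>0$, $\sigma\in\mathbb R$ and $u_0\in\mathbb R$. Then the integral equation in $(\mathcal S)^{-1}$ $$U_t^\varphi=u_0-\theta\int_0^tU_s^\varphi\,ds+\sigma X_\varphi(1_{[0,t)}),\qquad t\ge0,$$ has the solution $$U_t^\varphi=u_0e^{-\theta t}+\sigma X_\varphi(1_{[0,t)})-\sigma\theta\int_0^te^{\theta(s-t)}X_\varphi(1_{[0,s)})\,ds,\qquad t\ge0 .$$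
   Context: Bernstein function and kernels. $\varphi:(0,\infty)\to[0,\infty)$ is a complete Bernstein function of the form $\varphi(x)=\int_0^\infty(1-e^{-sx})\overline\nu(s)\,ds$, where $\overline\nu$ is a completely monotone Lévy density on $(0,\infty)$ ($\int_0^\infty(s\wedge1)\overline\nu(s)ds<\infty$). $\nu(x):=\int_x^\infty\overline\nu(z)dz$ for $x>0$ and $\nu(x):=0$ for $x\le 0$. $\kappa:(0,\infty)\to[0,\infty)$ is the (locally integrable, non-increasing) Sonine associate of $\nu$, i.e. $\int_0^\infty e^{-s\theta}\kappa(s)ds=1/\varphi(\theta)$, $\theta>0$; $\chi(x):=\int_0^x\kappa(z)dz$ for $x>0$, $\chi(x):=0$ for $x\le0$. Conditions. (C): $\lim_{\theta\to0}\varphi(\theta)=0$ and $\lim_{\theta\to\infty}\varphi(\theta)=+\infty$. (K): $\lim_{\theta\to0}\varphi(\theta)/\theta=+\infty$ and $\lim_{\theta\to\infty}\varphi(\theta)/\theta=0$. (A1): $\overline\nu\in L^2(1,\infty)$. (A2): $\nu\in L^2(0,1)\cap L^p(1,\infty)$ for some $p\ge1$. (B1): $\kappa\in L^1(0,\varepsilon)\cap L^2(\varepsilon,\infty)$ for every $\varepsilon>0$. (B2): $\chi\in L^2(0,\varepsilon)$ for every $\varepsilon>0$. Operators. For $f\in L^1(\mathbb R)$: $(\mathcal D_-^{(\nu)}f)(x)=-\frac{d}{dx}\int_x^\infty f(t)\nu(t-x)dt$ (distributional derivative), $(\mathcal I_-^{(\kappa)}f)(x)=\int_x^\infty f(t)\kappa(t-x)dt$.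 In particular $\mathcal D_-^{(\nu)}1_{[0,t)}(u)=\nu((t-u)_+)-\nu((-u)_+)$ and $\mathcal I_-^{(\kappa)}1_{[0,t)}(u)=\chi((t-u)_+)-\chi((-u)_+)$, in $L^2(\mathbb R)$ under (A1)-(A2), respectively (B1)-(B2). $C_\nu=\big(\int_{\mathbb R}[\nu((1-u)_+)-\nu((-u)_+)]^2du\big)^{-1}$, $C_\kappa=\big(\int_{\mathbb R}[\chi((1-u)_+)-\chi((-u)_+)]^2du\big)^{-1}$, $\mathcal M_-^{(\nu)}:=\sqrt{C_\nu}\,\mathcal D_-^{(\nu)}$, $\mathcal M_-^{(\kappa)}:=\sqrt{C_\kappa}\,\mathcal I_-^{(\kappa)}$. White noise space. $\mathcal S=\mathcal S(\mathbb R)$, $\mathcal S_{\mathbb C}$ its complexification, $\mathcal S'$ its dual with the cylinder $\sigma$-field $\mathcal B$, $\mu$ the white noise measure: $\int_{\mathcal S'}e^{i\langle\omega,\xi\rangle}d\mu(\omega)=e^{-\frac12\|\xi\|_{L^2}^2}$, $\xi\in\mathcal S$. For $f\in L^2(\mathbb R)$, $\langle\omega,f\rangle$ is the $\mu$-a.s. defined $L^2(\mu)$-extension of the dual pairing. Distribution space $(\mathcal S)^{-1}$. Let $A=-\frac{d^2}{dx^2}+x^2+1$, $\|f^{(n)}\|_p:=\|(A^p)^{\otimes n}f^{(n)}\|_{L^2(\mathbb R^n)}$, $p\in\mathbb Z$. Elements $F$ of $(L^2):=L^2(\mathcal S',\mathcal B,\mu)$ have chaos decompositions $F=\sum_n\langle:\omega^{\otimes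 n}:,f^{(n)}\rangle$. $(\mathcal S)^{-1}\supset(L^2)$ is the inductive limit over $p,q\in\mathbb N$ of the Hilbert spaces of generalized chaos expansions $\Phi=(\Phi^{(n)})_n$ with $\sum_n2^{-nq}\|\Phi^{(n)}\|^2_{-p}<\infty$. The $S$-transform of $\Phi\in(\mathcal S)^{-1}$ is $(S\Phi)(\xi)=e^{-\frac12\langle\xi,\xi\rangle}\int_{\mathcal S'}e^{\langle\omega,\xi\rangle}\Phi(\omega)\mu(d\omega)=\sum_n\langle\Phi^{(n)},\xi^{\otimes n}\rangle$ (integral understood as a dual pairing) for $\xi$ in a neighbourhood $\{\xi\in\mathcal S_{\mathbb C}:2^q\|\xi\|_p^2<1\}$ of zero; it determines $\Phi$. Integrals. For $(\mathcal S)^{-1}$-valued $s\mapsto\Phi_s$, $\int_0^t\Phi_s\,ds$ denotes the element of $(\mathcal S)^{-1}$ with $S\big(\int_0^t\Phi_sds\big)(\xi)=\int_0^t(S\Phi_s)(\xi)\,ds$ for $\xi$ in a neighbourhood of zero. *)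

(* Defs.v *)
From HB Require Import structures.
From mathcomp Require Import all_boot all_order all_algebra all_fingroup.
From mathcomp Require Import complex.
From mathcomp Require Import all_classical all_reals all_analysis.

Set Implicit Arguments.
Unset Strict Implicit.
Unset Printing Implicit Defensive.
Import Order.TTheory GRing.Theory Num.Theory.
Import numFieldNormedType.Exports.

Local Open Scope classical_set_scope.
Local Open Scope ring_scope.
Local Open Scope complex_scope.

Notation leb R := (@lebesgue_measure R).

(* A function whose mathematical domain is (0, +oo) is a total function R -> R;
   the conditions below constrain its values on (0, +oo) only. *)

Section Kernels.
Variable R : realType.
Implicit Types (phi nubar nu kappa f g : R -> R) (D : set R).

Definition completely_monotone f : Prop :=
  forall (n : nat) (x : R), 0 < x ->
    derivable (derive1n n f) x 1 /\ 0 <= (-1) ^+ n * derive1n n f x.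

Definition levy_density nubar : Prop :=
  measurable_fun (`]0, +oo[ : set R) nubar /\
  (\int[leb R]_(s in `]0%R, +oo[) (Num.min s 1 * nubar s)%:E < +oo)%E.

(* [phi] has neither killing nor drift; [nubar] is its Levy density *)
Definition complete_bernstein phi nubar : Prop :=
  [/\ completely_monotone nubar,
      levy_density nubar,
      forall x, 0 < x -> 0 <= phi x &
      forall x, 0 < x -> (phi x)%:E =
        (\int[leb R]_(s in `]0%R, +oo[) ((1 - expR (- (s * x))) * nubar s)%:E)%E].

Definition levy_tail nubar (x : R) : R :=
  if 0 < x then \int[leb R]_(z in `]x, +oo[) nubar z else 0.

Definition sonine_associate phi kappa : Prop :=
  [/\ forall x, 0 < x -> 0 <= kappa x,
      forall x y, 0 < x -> x <= y -> kappa y <= kappa x,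
      forall a, 0 < a -> (leb R).-integrable `]0, a] (EFin \o kappa) &
      forall theta, 0 < theta ->
        (\int[leb R]_(s in `]0%R, +oo[) (expR (- (s * theta)) * kappa s)%:E)%E
        = ((phi theta)^-1)%:E].

Definition sonine_primitive kappa (x : R) : R :=
  if 0 < x then \int[leb R]_(z in `]0, x]) kappa z else 0.

Definition condC phi : Prop :=
  phi x @[x --> 0^'+] --> (0 : R) /\ phi x @[x --> +oo] --> +oo.

Definition condK phi : Prop :=
  phi x / x @[x --> 0^'+] --> +oo /\ phi x / x @[x --> +oo] --> (0 : R).

Definition Lp_on D (p : R) f : Prop :=
  measurable_fun D f /\
  (\int[leb R]_(x in D) (`|f x| `^ p)%:E < +oo)%E.

Definition condA1 nubar : Prop := Lp_on (`]1, +oo[) 2 nubar.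

Definition condA2 nu : Prop :=
  Lp_on (`]0, 1[) 2 nu /\ exists2 p : R, 1 <= p & Lp_on (`]1, +oo[) p nu.

Definition condB1 kappa : Prop :=
  forall eps, 0 < eps -> Lp_on (`]0, eps[) 1 kappa /\ Lp_on (`]eps, +oo[) 2 kappa.

Definition condB2 (chi : R -> R) : Prop :=
  forall eps, 0 < eps -> Lp_on (`]0, eps[) 2 chi.

(* (int_R [k((1-u)_+) - k((-u)_+)]^2 du)^-1, giving C_nu for k = nu and
   C_kappa for k = chi *)
Definition norm_const (k : R -> R) : R :=
  (\int[leb R]_u (k (Num.max (1 - u) 0) - k (Num.max (- u) 0)) ^+ 2)^-1.

(* x |-> int_x^oo f(t) k(t - x) dt *)
Definition right_conv (k : R -> R) f (x : R) : R :=
  \int[leb R]_(t in `]x, +oo[) (f t * k (t - x)).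

End Kernels.

Section Schwartz.
Variable R : realType.

Definition schwartz_prop (f : R -> R) : Prop :=
  (forall n x, derivable (derive1n n f) x 1) /\
  (forall m n, exists C : R, forall x, `|x ^+ m * derive1n n f x| <= C).

Definition schwartz_pred : {pred R -> R^o} := fun f => `[< schwartz_prop f >].

Lemma schwartz_derive1n_lin (a : R) (f g : R -> R^o) :
  (forall n x, derivable (derive1n n f) x 1) ->
  (forall n x, derivable (derive1n n g) x 1) ->
  forall n, derive1n n ((a *: f + g) : R -> R^o) = a *: derive1n n f + derive1n n g.
Proof.
move=> df dg; elim=> [//|n IHn].
rewrite !derive1nS IHn; apply/funext => x.
have daf : derivable (a *: derive1n n f) x 1 by exact: derivableZ (df n x).
rewrite derive1E deriveD// deriveZ//.
by rewrite
  -[RHS]/(a *: derive1 (derive1n n f) x + derive1 (derive1n n g) x) !derive1E.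
Qed.

Fact schwartz_submod_closed : submod_closed schwartz_pred.
Proof.
split=> [|a f g].
  have z n : derive1n n (0 : R -> R^o) = 0.
    elim: n => [//|n IHn]; rewrite derive1nS IHn.
    by apply/funext => x; rewrite derive1_cst.
  apply/asboolP; split=> [n x|m n]; first by rewrite z; exact: derivable_cst.
  by exists 0 => x; rewrite z mulr0 normr0.
rewrite !unfold_in => /asboolP[df bf] /asboolP[dg bg].
apply/asboolP; have L := schwartz_derive1n_lin a df dg.
split=> [n x|m n].
  by rewrite L; apply: derivableD; [exact: derivableZ|].
have [C1 H1] := bf m n; have [C2 H2] := bg m n.
exists (`|a| * C1 + C2) => x; rewrite L.
rewrite -[(_ + _) x]/(a * derive1n n f x + derive1n n g x) mulrDr.
apply: (le_trans (ler_normD _ _)); apply: lerD; last exact: H2.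
by rewrite mulrCA normrM ler_wpM2l.
Qed.

HB.instance Definition _ :=
  GRing.isSubmodClosed.Build R (R -> R^o) schwartz_pred schwartz_submod_closed.

Record schwartz := Schwartz {
  schwartz_fun :> R -> R^o ;
  schwartzP : schwartz_fun \in schwartz_pred }.

HB.instance Definition _ := [isSub for schwartz_fun].
HB.instance Definition _ := [Choice of schwartz by <:].
HB.instance Definition _ := [SubChoice_isSubLmodule of schwartz by <:].

(* continuity at 0, hence everywhere by linearity, for the topology of the
   seminorms sup_x |x^a f^(b)(x)| *)
Definition schwartz_continuous (w : schwartz -> R) : Prop :=
  forall eps : R, 0 < eps -> exists (m : nat) (delta : R), 0 < delta /\
    forall f : schwartz,
      (forall (a b : nat) (x : R), (a <= m)%N -> (b <= m)%N ->
        `|x ^+ a * derive1n b f x| <= delta) -> `|w f| <= eps.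

Definition tempered_prop (w : schwartz -> R) : Prop :=
  (forall (a : R) (f g : schwartz), w (a *: f + g) = a * w f + w g) /\
  schwartz_continuous w.

Record tempered := Tempered {
  tempered_fun :> schwartz -> R ;
  temperedP : tempered_prop tempered_fun }.

Fact tempered0_subproof : tempered_prop (fun _ => 0).
Proof.
split=> [a f g|eps eps0]; first by rewrite mulr0 addr0.
by exists 0%N, 1; split=> // f _; rewrite normr0 ltW.
Qed.

HB.instance Definition _ := gen_eqMixin tempered.
HB.instance Definition _ := gen_choiceMixin tempered.
HB.instance Definition _ := isPointed.Build tempered (Tempered tempered0_subproof).

Definition cylinders : set (set tempered) :=
  [set A | exists (xi : schwartz) (B : set R),
     measurable B /\ A = [set w : tempered | B (w xi)]].

Definition wn_space := g_sigma_algebraType cylinders.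

HB.instance Definition _ := Measurable.on wn_space.

Definition wn_pair (w : wn_space) (xi : schwartz) : R := (w : tempered) xi.

(* real and imaginary parts of int e^{i<w,xi>} dmu = e^{-|xi|^2/2} *)
Definition white_noise (mu : probability wn_space R) : Prop :=
  forall xi : schwartz,
    (\int[mu]_w (cos (wn_pair w xi))%:E)%E
      = (expR (- (2^-1 * \int[leb R]_x (xi x ^+ 2))))%:E /\
    (\int[mu]_w (sin (wn_pair w xi))%:E)%E = 0%E.

(* [Y] is a version of w |-> <w, f>: (f, Y) lies in the closure of the graph
   of the isometry S -> L^2(mu), xi |-> <., xi> *)
Definition wn_pairing (mu : probability wn_space R) (f : R -> R)
    (Y : wn_space -> R) : Prop :=
  [/\ measurable_fun setT f, measurable_fun setT Y &
      exists xi : nat -> schwartz,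
        (\int[leb R]_x ((xi n x - f x) ^+ 2)%:E)%E @[n --> \oo] --> 0%E /\
        (\int[mu]_w ((wn_pair w (xi n) - Y w) ^+ 2)%:E)%E @[n --> \oo] --> 0%E].

(* [h] is an L^2-representative of M_-^(nu) 1_[0,t) = sqrt(C_nu) g, where
   g = - d/dx right_conv nu 1_[0,t) in the sense of distributions *)
Definition M_nu (nu : R -> R) (t : R) (h : R -> R) : Prop :=
  exists g : R -> R,
    [/\ Lp_on setT 2 g,
        forall psi : schwartz, \int[leb R]_x (g x * psi x) =
          \int[leb R]_x (right_conv nu \1_(`[0, t[) x * derive1 psi x) &
        h = fun x => Num.sqrt (norm_const nu) * g x].

Definition M_kappa (kappa : R -> R) (t : R) : R -> R := fun x =>
  Num.sqrt (norm_const (sonine_primitive kappa)) *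
  right_conv kappa \1_(`[0, t[) x.

(* The complexification of S: the pair (f, g) stands for f + i g. *)
Definition schwartzC := (schwartz * schwartz)%type.

Definition scaleC (z : R[i]) (xi : schwartzC) : schwartzC :=
  (complex.Re z *: xi.1 - complex.Im z *: xi.2,
   complex.Re z *: xi.2 + complex.Im z *: xi.1).

Definition pairC (w : wn_space) (xi : schwartzC) : R[i] :=
  wn_pair w xi.1 +i* wn_pair w xi.2.

(* int xi eta dx, bilinear *)
Definition dotC (xi eta : schwartzC) : R[i] :=
  (\int[leb R]_x (xi.1 x * eta.1 x - xi.2 x * eta.2 x)) +i*
  (\int[leb R]_x (xi.1 x * eta.2 x + xi.2 x * eta.1 x)).

(* A = - d^2/dx^2 + x^2 + 1 *)
Definition opA (f : R -> R) : R -> R :=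
  fun x => - derive1n 2 f x + x ^+ 2 * f x + f x.

(* int (A^p xi) (conj (A^p eta)) dx, sesquilinear *)
Definition gramA (p : nat) (xi eta : schwartzC) : R[i] :=
  let a := iter p opA xi.1 in let b := iter p opA xi.2 in
  let c := iter p opA eta.1 in let d := iter p opA eta.2 in
  (\int[leb R]_x (a x * c x + b x * d x)) +i*
  (\int[leb R]_x (b x * c x - a x * d x)).

Definition normA2 (p : nat) (xi : schwartzC) : R := complex.Re (gramA p xi xi).

(* The list [(c_1, xi_1); (c_2, xi_2); etc] stands for the element
   sum_j c_j xi_j0 (x) xi_j1 (x) etc of the algebraic tensor power of S_C. *)
Definition tensor (n : nat) := seq (R[i] * ('I_n -> schwartzC)).

(* |(A^p)^{(x)n} g|^2 in L^2(R^n) *)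
Definition tensor_norm2 (p n : nat) (g : tensor n) : R :=
  complex.Re (\sum_(a <- g) \sum_(b <- g)
    a.1 * (b.1)^* * \prod_(i < n) gramA p (a.2 i) (b.2 i)).

(* A generalized kernel of order n is given by its dual pairing with
   elementary tensors, an n-linear form on S_C. *)
Definition kernel (n : nat) := ('I_n -> schwartzC) -> R[i].

Definition kernel_pair (n : nat) (K : kernel n) (g : tensor n) : R[i] :=
  \sum_(a <- g) a.1 * K a.2.

(* |K|_{-p}^2. As A^p maps S onto S and is symmetric, the L^2-norm of
   (A^{-p})^{(x)n} K is the supremum of |<K, g>| over |g|_p <= 1. *)
Definition kernel_norm2 (p n : nat) (K : kernel n) : \bar R :=
  ereal_sup [set (Normc.normc (kernel_pair K g) ^+ 2)%:E
            | g in [set g : tensor n | tensor_norm2 p g <= 1]].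

Definition subst_arg n (xi : 'I_n -> schwartzC) (i : 'I_n) (eta : schwartzC) :=
  fun j => if j == i then eta else xi j.

Definition multilinearC n (K : kernel n) : Prop :=
  forall (xi : 'I_n -> schwartzC) (i : 'I_n) (z : R[i]) (eta zeta : schwartzC),
    K (subst_arg xi i (scaleC z eta + zeta)) =
    z * K (subst_arg xi i eta) + K (subst_arg xi i zeta).

Definition symmetricC n (K : kernel n) : Prop :=
  forall (s : 'S_n) (xi : 'I_n -> schwartzC), K (fun i => xi (s i)) = K xi.

(* generalized chaos expansions (Phi^(n))_n *)
Definition chaos := forall n : nat, kernel n.

Definition S1 (Phi : chaos) : Prop :=
  (forall n, multilinearC (Phi n) /\ symmetricC (Phi n)) /\
  exists p q : nat,
    (\sum_(0 <= n <oo) ((2^-1 ^+ (n * q))%:E * kernel_norm2 p (Phi n)) < +oo)%E.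

Definition chaos_add (Phi Psi : chaos) : chaos :=
  fun n xi => Phi n xi + Psi n xi.

Definition chaos_scale (a : R) (Phi : chaos) : chaos :=
  fun n xi => a%:C * Phi n xi.

Definition chaos_const (a : R) : chaos :=
  fun n _ => if n == 0%N then a%:C else 0.

(* (S Phi)(xi) = sum_n <Phi^(n), xi^{(x)n}> converges and equals [z] *)
Definition S_transform (Phi : chaos) (xi : schwartzC) (z : R[i]) : Prop :=
  (\sum_(0 <= n < N) complex.Re (Phi n (fun _ => xi))) @[N --> \oo]
    --> complex.Re z /\
  (\sum_(0 <= n < N) complex.Im (Phi n (fun _ => xi))) @[N --> \oo]
    --> complex.Im z.

(* [I] is the integral of s |-> [Phi s] over [0, t] *)
Definition S1_integral (t : R) (Phi : R -> chaos) (I : chaos) : Prop :=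
  [/\ forall s, 0 <= s <= t -> S1 (Phi s),
      S1 I &
      exists p q : nat, forall xi : schwartzC, 2 ^+ q * normA2 p xi < 1 ->
        exists F : R -> R[i],
          [/\ forall s, 0 <= s <= t -> S_transform (Phi s) xi (F s),
              (leb R).-integrable `[0, t] (EFin \o (@complex.Re R \o F)),
              (leb R).-integrable `[0, t] (EFin \o (@complex.Im R \o F)) &
              S_transform I xi
                ((\int[leb R]_(s in `[0, t]) complex.Re (F s)) +i*
                 (\int[leb R]_(s in `[0, t]) complex.Im (F s)))]].

(* <:w^{(x)n}:, xi_0 (x) etc (x) xi_{n-1}>, by the recursion
   :w^{(x)(n+1)}: = w (x) :w^{(x)n}: - n tau (x) :w^{(x)(n-1)}: (symmetrized),
   tau being the trace <tau, xi (x) eta> = int xi eta dx *)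
Fixpoint wick (w : wn_space) (n : nat) : kernel n :=
  match n return kernel n with
  | 0%N => fun _ => 1
  | n1.+1 => fun xi =>
      pairC w (xi ord0) * wick w (fun i : 'I_n1 => xi (lift ord0 i)) -
      match n1 return kernel n1 with
      | 0%N => fun _ => 0
      | n2.+1 => fun eta =>
          \sum_(i < n2.+1) dotC (xi ord0) (eta i) *
            wick w (fun j : 'I_n2 => eta (lift i j))
      end (fun i => xi (lift ord0 i))
  end.

(* the kernel of the symmetrization of [g], acting by the bilinear pairing of
   L^2(R^n) *)
Definition tensor_kernel n (g : tensor n) : kernel n := fun eta =>
  ((n`!)%:R)^-1 * \sum_(a <- g)
    a.1 * \sum_(s : 'S_n) \prod_(i < n) dotC (a.2 (s i)) (eta i).

Definition L2dist2 (mu : probability wn_space R) (Y Z : wn_space -> R[i]) :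
    \bar R :=
  (\int[mu]_w (Normc.normc (Y w - Z w) ^+ 2)%:E)%E.

Definition measurableC (Y : wn_space -> R[i]) : Prop :=
  measurable_fun setT (@complex.Re R \o Y) /\
  measurable_fun setT (@complex.Im R \o Y).

(* [K] is (the functional given by) a symmetric kernel in L^2(R^n) and
   Y = <:w^{(x)n}:, K>, as the L^2(mu)-limit along smooth kernels *)
Definition wick_limit (mu : probability wn_space R) n (K : kernel n)
    (Y : wn_space -> R[i]) : Prop :=
  measurableC Y /\
  exists g : nat -> tensor n,
    kernel_norm2 0 (fun eta => tensor_kernel (g m) eta - K eta)
      @[m --> \oo] --> 0%E /\
    L2dist2 mu (fun w => kernel_pair (wick w (n:=n)) (g m)) Y
      @[m --> \oo] --> 0%E.

(* F = sum_n <:w^{(x)n}:, Phi^(n)> in L^2(mu); this is the inclusion of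
   L^2(mu) in (S)^{-1} *)
Definition chaos_decomposition (mu : probability wn_space R)
    (F : wn_space -> R) (Phi : chaos) : Prop :=
  exists Y : nat -> wn_space -> R[i],
    (forall n, wick_limit mu (Phi n) (Y n)) /\
    L2dist2 mu (fun w => \sum_(n < N) Y n w) (fun w => (F w)%:C)
      @[N --> \oo] --> 0%E.

End Schwartz.

(* Main.v *)
(** The process enters only through the linear forms L_t(psi) = int h_t psi on
    the Schwartz space: X_phi(1_[0,t)) is the first-order chaos with kernel L_t,
    and every element of (S)^{-1} in the statement has the form a + <w, L>, so
    that the integral equation reduces to the scalar identity
    int_0^t (f(s) - theta int_0^s e^{theta(r-s)} f(r) dr) ds
    = int_0^t e^{theta(r-t)} f(r) dr for f(s) = L_s(psi), which is Fubini.

    What remains is that s |-> L_s(psi) is measurable and that the L^2-norm of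
    L_s is bounded locally uniformly in s.  Let r_s(x) = int_x^oo 1_[0,s)(t)
    k(t - x) dt, with k = nu or kappa; it is nonnegative and nondecreasing in s.
    For kappa, h_s is a multiple of r_s, whence |h_s| <= |h_t| for s <= t.  For
    nu, h_s is a multiple of the weak derivative - r_s', and Fubini gives
    int r_s psi' = int (k(u + s) - k(u)) psi(-u) du, where k(u) - k(u + s) is at
    most s nubar(u) because nubar is nonincreasing.  In both cases L_s(psi) is an
    integral of r_s against a fixed function, hence a difference of two monotone
    functions of s. *)

Require Import Defs.
From HB Require Import structures.
From mathcomp Require Import all_boot all_order all_algebra all_fingroup.
From mathcomp Require Import complex.
From mathcomp Require Import all_classical all_reals all_analysis.
From mathcomp Require Import measurable_realfun ring lra.
Import Order.TTheory GRing.Theory Num.Theory.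
Import numFieldNormedType.Exports.
Local Open Scope classical_set_scope.
Local Open Scope ring_scope.
Set Implicit Arguments.
Unset Strict Implicit.
Unset Printing Implicit Defensive.

(** * Square-integrable real functions and the Cauchy-Schwarz inequality *)

Section CauchySchwarz.
Context (d : measure_display) (T : measurableType d) (R : realType).
Variable mu : {measure set T -> \bar R}.
Implicit Types f g : T -> R.

Definition sq_integrable f : Prop :=
  measurable_fun setT f /\ mu.-integrable setT (EFin \o (fun x => f x ^+ 2)).

Lemma sq_integrableP f : measurable_fun setT f ->
  (\int[mu]_x (f x ^+ 2)%:E < +oo)%E -> sq_integrable f.
Proof.
move=> mf fi; split=> //; apply/integrableP; split.
  by apply/measurable_EFinP; exact: measurable_funX.
by under eq_integral do rewrite /= ger0_norm ?sqr_ge0//.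
Qed.

(** The product is dominated by [f ^+ 2 + g ^+ 2]. *)
Lemma sq_integrableM f g : sq_integrable f -> sq_integrable g ->
  mu.-integrable setT (EFin \o (fun x => f x * g x)).
Proof.
move=> [mf fi] [mg gi].
apply: (le_integrable measurableT _ _ (integrableD measurableT fi gi)).
  by apply/measurable_EFinP; exact: measurable_funM.
move=> x _ /=; rewrite lee_fin (ger0_norm (addr_ge0 (sqr_ge0 _) (sqr_ge0 _))).
by rewrite ler_norml; apply/andP; split; nra.
Qed.

Lemma sq_integrableZ (c : R) f : sq_integrable f ->
  sq_integrable (fun x => c * f x).
Proof.
move=> [mf fi]; split; first exact: measurable_funM.
apply: eq_integrable (integrableZl measurableT (c ^+ 2) fi) => //.
by move=> x _ /=; rewrite exprMn EFinM.
Qed.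

Lemma sq_integrableD f g : sq_integrable f -> sq_integrable g ->
  sq_integrable (fun x => f x + g x).
Proof.
move=> Hf Hg; have fg := sq_integrableM Hf Hg.
case: Hf Hg => [mf fi] [mg gi]; split; first exact: measurable_funD.
apply: eq_integrable (integrableD measurableT
  (integrableD measurableT fi gi) (integrableZl measurableT 2 fg)) => //.
by move=> x _ /=; congr EFin; ring.
Qed.

(** The quadratic form [a ^+ 2 * A + 2 * a * b * P + b ^+ 2 * B] is the integral of
    [(a * f + b * g) ^+ 2], hence nonnegative for all [a], [b]; suitable values of [a], [b] give the
    discriminant inequality. *)
Lemma cauchy_schwarz f g : sq_integrable f -> sq_integrable g ->
  (\int[mu]_x (f x * g x)) ^+ 2 <=
  (\int[mu]_x (f x ^+ 2)) * (\int[mu]_x (g x ^+ 2)).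
Proof.
move=> Hf Hg; have fg := sq_integrableM Hf Hg.
set A := \int[mu]_x (f x ^+ 2); set B := \int[mu]_x (g x ^+ 2).
set P := \int[mu]_x (f x * g x).
have A0 : 0 <= A by apply: Rintegral_ge0 => x _; exact: sqr_ge0.
have B0 : 0 <= B by apply: Rintegral_ge0 => x _; exact: sqr_ge0.
have Q (a b : R) : 0 <= a ^+ 2 * A + 2 * a * b * P + b ^+ 2 * B.
  have -> : a ^+ 2 * A + 2 * a * b * P + b ^+ 2 * B =
      \int[mu]_x ((a * f x + b * g x) ^+ 2).
    rewrite -!RintegralZl//; try by case: Hf => []; case: Hg => [].
    rewrite -!RintegralD//.
    - by apply: eq_Rintegral => x _; ring.
    - exact: (integrableD measurableT (integrableZl measurableT (a ^+ 2) Hf.2)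
        (integrableZl measurableT (2 * a * b) fg)).
    - exact: (integrableZl measurableT (b ^+ 2) Hg.2).
    - exact: (integrableZl measurableT (a ^+ 2) Hf.2).
    - exact: (integrableZl measurableT (2 * a * b) fg).
  by apply: Rintegral_ge0 => x _; exact: sqr_ge0.
have [B00|Bn0] := eqVneq B 0.
  have [P0|Pn0] := eqVneq P 0; first by rewrite P0 B00; lra.
  (* With [B = 0] the form is affine in [b]; this [b] gives it the value [- A - 2], which is
     negative and contradicts [Q]. *)
  have := Q 1 (- ((A + 1) / P)); rewrite B00.
  have -> : 2 * 1 * - ((A + 1) / P) * P = - 2 * (A + 1) by field.
  by lra.
have := Q B (- P).
have -> : B ^+ 2 * A + 2 * B * - P * P + (- P) ^+ 2 * B = B * (A * B - P ^+ 2).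
  by ring.
by rewrite pmulr_rge0 ?subr_ge0// lt_def Bn0.
Qed.

End CauchySchwarz.

(** * Translation and reflection invariance of Lebesgue measure and its integrals *)

Section Invariance.
Variable R : realType.
Notation leb := (@lebesgue_measure R).
Implicit Types (f : R -> R) (a : R).

(** The pushforward under the translation agrees with Lebesgue measure on the half-open intervals,
    so uniqueness of the extension applies. *)
Lemma lebesgue_measure_shift a (A : set R) : measurable A ->
  leb A = leb ((fun x => x + a) @^-1` A).
Proof.
move=> mA.
have mphi : measurable_fun [set: measurableTypeR R]
  ((fun x => x + a) : measurableTypeR R -> measurableTypeR R).
  by apply: measurable_funD => //; exact: measurable_cst.
rewrite (@lebesgue_measure_unique R (pushforward leb
  (fun x : measurableTypeR R => (x + a : measurableTypeR R)))) //.
move=> X [[x y] _ <-]; rewrite /pushforward.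
transitivity (leb `]x - a, y - a]%classic); last first.
  congr (leb _).
  by apply/seteqP; split=> z /=; rewrite !in_itv/= => /andP[? ?]; apply/andP; split; lra.
rewrite !lebesgue_measure_itv/= !lte_fin ltrD2r; case: ifP => //= _.
by rewrite -!EFinD; congr EFin; ring.
Qed.

(** Same uniqueness argument; reflection turns []x, y]] into [[- y, - x[], closed at the other end
    but of equal length. *)
Lemma lebesgue_measure_opp (A : set R) : measurable A ->
  leb A = leb (-%R @^-1` A).
Proof.
move=> mA.
have mphi : measurable_fun [set: measurableTypeR R]
  (-%R : measurableTypeR R -> measurableTypeR R) by exact: oppr_measurable.
rewrite (@lebesgue_measure_unique R (pushforward leb
  (-%R : measurableTypeR R -> measurableTypeR R))) //.
move=> X [[x y] _ <-]; rewrite /pushforward.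
transitivity (leb `[- y, - x[%classic); last first.
  congr (leb _).
  by apply/seteqP; split=> z /=; rewrite !in_itv/= => /andP[? ?]; apply/andP; split; lra.
rewrite !lebesgue_measure_itv/= !lte_fin ltrN2; case: ifP => //= _.
by rewrite -!EFinD; congr EFin; ring.
Qed.

Lemma ge0_integral_shift a (f : R -> \bar R) : measurable_fun setT f ->
  (forall x, 0 <= f x)%E -> (\int[leb]_x f (x + a)%R = \int[leb]_x f x)%E.
Proof.
move=> mf f0.
have mphi : measurable_fun [set: measurableTypeR R]
  ((fun x => x + a) : measurableTypeR R -> measurableTypeR R).
  by apply: measurable_funD => //; exact: measurable_cst.
rewrite -(@ge0_integral_pushforward _ _ (measurableTypeR R) (measurableTypeR R)
  R _ mphi leb setT f measurableT mf); last by move=> x _; exact: f0.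
apply: eq_measure_integral => A mA _; apply/esym; exact: lebesgue_measure_shift.
Qed.

Lemma ge0_integral_opp (f : R -> \bar R) : measurable_fun setT f ->
  (forall x, 0 <= f x)%E -> (\int[leb]_x f (- x)%R = \int[leb]_x f x)%E.
Proof.
move=> mf f0.
have mphi : measurable_fun [set: measurableTypeR R]
  (-%R : measurableTypeR R -> measurableTypeR R) by exact: oppr_measurable.
rewrite -(@ge0_integral_pushforward _ _ (measurableTypeR R) (measurableTypeR R)
  R _ mphi leb setT f measurableT mf); last by move=> x _; exact: f0.
apply: eq_measure_integral => A mA _; apply/esym; exact: lebesgue_measure_opp.
Qed.

Lemma measurable_shift a (d : measure_display) (U : measurableType d)
  (f : R -> U) : measurable_fun setT f -> measurable_fun setT (fun x : R => f (x + a)).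
Proof.
move=> mf; apply: (measurableT_comp mf).
by apply: measurable_funD => //; exact: measurable_cst.
Qed.

Lemma integrable_shift a f : leb.-integrable setT (EFin \o f) ->
  leb.-integrable setT (EFin \o (fun x => f (x + a))).
Proof.
move=> /integrableP[mf fi]; apply/integrableP; split.
  exact: (measurable_shift a mf).
rewrite (ge0_integral_shift a (f := fun x => `|(EFin \o f) x|%E))//.
exact: measurableT_comp.
Qed.

Lemma integrable_opp f : leb.-integrable setT (EFin \o f) ->
  leb.-integrable setT (EFin \o (fun x => f (- x))).
Proof.
move=> /integrableP[mf fi]; apply/integrableP; split.
  by apply: (measurableT_comp mf); exact: oppr_measurable.
rewrite (ge0_integral_opp (f := fun x => `|(EFin \o f) x|%E))//.
exact: measurableT_comp.
Qed.

Lemma Rintegral_shift a f : leb.-integrable setT (EFin \o f) ->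
  \int[leb]_x f (x + a) = \int[leb]_x f x.
Proof.
move=> /integrableP[mf fi]; rewrite /Rintegral; congr fine.
rewrite integralE [RHS]integralE; congr (_ - _)%E.
  rewrite -(ge0_integral_shift a (f := (EFin \o f)^\+%E)).
  - by apply: eq_integral => x _; rewrite !funeposE.
  - exact: measurable_funepos.
  - exact: funepos_ge0.
rewrite -(ge0_integral_shift a (f := (EFin \o f)^\-%E)).
- by apply: eq_integral => x _; rewrite !funenegE.
- exact: measurable_funeneg.
- exact: funeneg_ge0.
Qed.

End Invariance.

(** * Integrability on a subset and extension by zero *)

Section Restriction.
Variable R : realType.
Notation leb := (@lebesgue_measure R).
Implicit Types (D : set R) (f : R -> R).

Lemma integrable_patch D f : measurable D ->
  leb.-integrable D (EFin \o f) -> leb.-integrable setT (EFin \o (f \_ D)).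
Proof.
move=> mD fi; rewrite -restrict_EFin.
by have [H _] := @integrable_mkcond _ _ R leb D (EFin \o f) mD; exact: H.
Qed.

Lemma integrable_unpatch D f : measurable D ->
  leb.-integrable setT (EFin \o (f \_ D)) -> leb.-integrable D (EFin \o f).
Proof.
rewrite -restrict_EFin => mD fi.
by have [_ H] := @integrable_mkcond _ _ R leb D (EFin \o f) mD; exact: H.
Qed.

Lemma Lp_on2_sq_integrable D f : measurable D -> Lp_on D 2 f ->
  sq_integrable leb (f \_ D).
Proof.
move=> mD [mf fi]; have mfD : measurable_fun setT (f \_ D).
  by apply/(measurable_restrictT _ _).1.
apply: sq_integrableP => //; move: fi; apply: le_lt_trans.
rewrite [leRHS]integral_mkcond le_eqVlt; apply/orP; left; apply/eqP.
apply: eq_integral => x _.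
rewrite !patchE; case: ifP => _; last by rewrite expr0n.
by rewrite (powR_mulrn 2)// real_normK// num_real.
Qed.

End Restriction.

(** * Boundedness, integrability and derivatives of Schwartz functions *)

Section SchwartzFacts.
Variable R : realType.
Notation leb := (@lebesgue_measure R).
Implicit Types psi : schwartz R.

Lemma schwartz_propP psi : schwartz_prop psi.
Proof. by have := schwartzP psi; rewrite unfold_in => /asboolP. Qed.

Lemma schwartz_linE (a : R) (f g : schwartz R) x :
  (a *: f + g) x = a * f x + g x.
Proof. by []. Qed.

Lemma derivable_schwartz psi x : derivable psi x 1.
Proof. exact: ((schwartz_propP psi).1 0%N x). Qed.

Lemma continuous_schwartz psi : continuous psi.
Proof.
move=> x; apply: differentiable_continuous; apply/derivable1_diffP.
exact: derivable_schwartz.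
Qed.

Lemma measurable_schwartz psi : measurable_fun setT (psi : R -> R).
Proof. by apply: continuous_measurable_fun; exact: continuous_schwartz. Qed.

Fact derive1_schwartz_subproof psi : (derive1 psi : R -> R^o) \in @schwartz_pred R.
Proof.
rewrite unfold_in; apply/asboolP; have [dpsi bpsi] := schwartz_propP psi.
split=> [n x|m n]; first by rewrite -derive1Sn; exact: dpsi.
by have [C HC] := bpsi m n.+1; exists C => x; rewrite -derive1Sn.
Qed.

Definition derive_schwartz psi : schwartz R :=
  Schwartz (derive1_schwartz_subproof psi).

Lemma bounded_schwartz psi : exists2 C : R, 0 <= C & forall x, `|psi x| <= C.
Proof.
have [C HC] := (schwartz_propP psi).2 0%N 0%N.
have H x : `|psi x| <= C by have := HC x; rewrite expr0 mul1r.
by exists C => //; exact: le_trans (H 0).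
Qed.

(** The function is even, and its integral over the half-line is the known finite value coming from
    the arctangent. *)
Lemma integrable_oneDsqrV :
  leb.-integrable setT (EFin \o (fun x : R => (1 + x ^+ 2)^-1)).
Proof.
have c : continuous (fun x : R => (1 + x ^+ 2)^-1).
  exact: continuous_oneDsqrV.
have p (x : R) : 0 <= (1 + x ^+ 2)^-1.
  by rewrite invr_ge0 addr_ge0// sqr_ge0.
apply/integrableP; split.
  by apply/measurable_EFinP; exact: continuous_measurable_fun.
under eq_integral do rewrite /= ger0_norm//.
rewrite (ge0_symfun_integralT p c) => [|x]; last by rewrite /= sqrrN.
have := integral0y_oneDsqr R; rewrite set_itvcy => ->.
by rewrite -EFinM ltry.
Qed.

(** The seminorms with weights [1] and [x ^+ 2] bound [psi] by a multiple of the integrable function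
    [(1 + x ^+ 2)^-1]. *)
Lemma integrable_schwartz psi : leb.-integrable setT (EFin \o psi).
Proof.
have [_ b] := schwartz_propP psi.
have [C HC] := b 0%N 0%N; have [D HD] := b 2%N 0%N.
have CD x : `|psi x| <= (C + D) * (1 + x ^+ 2)^-1.
  have x1 : 0 < 1 + x ^+ 2 by rewrite ltr_pwDl// sqr_ge0.
  rewrite ler_pdivlMr// mulrDr mulr1.
  have := HC x; have := HD x; rewrite expr0 mul1r normrM normrX.
  by rewrite -(real_normK (num_real x)) mulrC/=; lra.
apply: (le_integrable measurableT _ _
  (integrableZl measurableT (C + D) integrable_oneDsqrV)).
  by apply/measurable_EFinP; exact: measurable_schwartz.
by move=> x _ /=; rewrite lee_fin (le_trans (CD x))// ler_norm.
Qed.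

Lemma sq_integrable_schwartz psi : sq_integrable leb psi.
Proof.
split; first exact: measurable_schwartz.
have [C C0 HC] := bounded_schwartz psi.
apply: (le_integrable measurableT _ _
  (integrableZl measurableT C (integrable_schwartz psi))).
  by apply/measurable_EFinP; apply: measurable_funX; exact: measurable_schwartz.
move=> x _ /=; rewrite lee_fin normrX normrM (ger0_norm C0) expr2.
by rewrite ler_wpM2r.
Qed.

End SchwartzFacts.

(** * The L^2 inner product on Schwartz space and tensors of order one *)

Section InnerProduct.
Local Open Scope complex_scope.
Variable R : realType.
Notation leb := (@lebesgue_measure R).
Implicit Types (f g h psi : schwartz R) (a : R).

Definition ip f g : R := \int[leb]_x (f x * g x).

Lemma integrable_ip f g : leb.-integrable setT (EFin \o (fun x => f x * g x)).
Proof. by apply: sq_integrableM; exact: sq_integrable_schwartz. Qed.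

Lemma ipC f g : ip f g = ip g f.
Proof. by apply: eq_Rintegral => x _; rewrite mulrC. Qed.

Lemma ip_linl a f g h : ip (a *: f + g) h = a * ip f h + ip g h.
Proof.
rewrite /ip -RintegralZl//; last exact: integrable_ip.
rewrite -RintegralD//; last exact: integrable_ip.
- by apply: eq_Rintegral => x _; rewrite schwartz_linE mulrDl mulrA.
- exact: (integrableZl measurableT a (integrable_ip f h)).
Qed.

Lemma ipDl f g h : ip (f + g) h = ip f h + ip g h.
Proof. by rewrite -[f]scale1r ip_linl scale1r mul1r. Qed.

Lemma ip0l h : ip 0 h = 0.
Proof. by have := ipDl 0 0 h; rewrite addr0; lra. Qed.

Lemma ipZl a f h : ip (a *: f) h = a * ip f h.
Proof. by rewrite -[a *: f]addr0 ip_linl ip0l addr0. Qed.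

Lemma ipNl f h : ip (- f) h = - ip f h.
Proof. by rewrite -scaleN1r ipZl mulN1r. Qed.

Lemma ip_ge0 f : 0 <= ip f f.
Proof. by apply: Rintegral_ge0 => x _; rewrite -expr2 sqr_ge0. Qed.

Lemma gramA0E (xi eta : schwartzC R) : gramA 0 xi eta =
  (ip xi.1 eta.1 + ip xi.2 eta.2) +i* (ip xi.2 eta.1 - ip xi.1 eta.2).
Proof.
rewrite /gramA/=; congr (_ +i* _).
  by rewrite RintegralD//; exact: integrable_ip.
by rewrite RintegralB//; exact: integrable_ip.
Qed.

Lemma dotCE (xi eta : schwartzC R) : dotC xi eta =
  (ip xi.1 eta.1 - ip xi.2 eta.2) +i* (ip xi.1 eta.2 + ip xi.2 eta.1).
Proof.
rewrite /dotC; congr (_ +i* _).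
  by rewrite RintegralB//; exact: integrable_ip.
by rewrite RintegralD//; exact: integrable_ip.
Qed.

Lemma normc_sqr (z : R[i]) :
  Normc.normc z ^+ 2 = complex.Re z ^+ 2 + complex.Im z ^+ 2.
Proof. by case: z => x y /=; rewrite sqr_sqrtr// addr_ge0// sqr_ge0. Qed.

(** The first tensor power of S_C is S_C itself, so a formal sum of order one can be evaluated to a
    single vector there. *)
Definition tensor1_sum (g : tensor R 1) : schwartzC R :=
  \sum_(a <- g) scaleC a.1 (a.2 ord0).

Lemma gramA0_suml (g : tensor R 1) (eta : schwartzC R) :
  gramA 0 (tensor1_sum g) eta = \sum_(a <- g) a.1 * gramA 0 (a.2 ord0) eta.
Proof.
rewrite /tensor1_sum; elim: g => [|[[x y] xi] g IHg].
  by rewrite !big_nil gramA0E/= !ip0l addr0 subr0.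
rewrite !big_cons -IHg !gramA0E/= !(ipDl, ipNl, ipZl).
by apply/eqP; rewrite eq_complex/=; apply/andP; split; apply/eqP; ring.
Qed.

Lemma gramA0C (xi eta : schwartzC R) : gramA 0 xi eta = (gramA 0 eta xi)^*.
Proof.
rewrite !gramA0E.
by apply/eqP; rewrite eq_complex/= !(ipC eta.1) !(ipC eta.2) opprB eqxx/= eqxx.
Qed.

(** By sesquilinearity the double sum over the terms of [g] collapses to the Gram form of the
    evaluated vector with itself. *)
Lemma tensor1_norm2E (g : tensor R 1) : tensor_norm2 0 g =
  ip (tensor1_sum g).1 (tensor1_sum g).1 + ip (tensor1_sum g).2 (tensor1_sum g).2.
Proof.
rewrite /tensor_norm2.
transitivity (complex.Re (gramA 0 (tensor1_sum g) (tensor1_sum g))); last first.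
  by rewrite gramA0E.
rewrite gramA0_suml; congr complex.Re; apply: eq_bigr => a _.
rewrite gramA0C gramA0_suml rmorph_sum mulr_sumr.
apply: eq_bigr => b _.
rewrite big_ord_recl big_ord0 mulr1 rmorphM (gramA0C (a.2 ord0)).
by rewrite mulrA.
Qed.

End InnerProduct.

(** * Chaos expansions with components of order zero and one only *)

Section AffineChaos.
Local Open Scope complex_scope.
Variable R : realType.
Notation leb := (@lebesgue_measure R).
Implicit Types (L : schwartz R -> R) (a C : R).

Definition linear_form L : Prop :=
  forall a f g, L (a *: f + g) = a * L f + L g.

(** [C] bounds the square of the L^2 operator norm of [L]; its sign is left free. *)
Definition L2_bounded C L : Prop := forall psi, L psi ^+ 2 <= C * ip psi psi.

(* a + <w, L> *)
Definition affine_chaos a L : chaos R := fun n =>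
  match n return Defs.kernel R n with
  | 0%N => fun _ => a%:C
  | 1%N => fun xi => L (xi ord0).1 +i* L (xi ord0).2
  | _ => fun _ => 0
  end.

Lemma linear_form0 L : linear_form L -> L 0 = 0.
Proof. by move=> lL; have := lL 1 0 0; rewrite scaler0 addr0; lra. Qed.

Lemma linear_formD L f g : linear_form L -> L (f + g) = L f + L g.
Proof. by move=> lL; rewrite -[f]scale1r lL scale1r mul1r. Qed.

Lemma linear_formZ L c f : linear_form L -> L (c *: f) = c * L f.
Proof. by move=> lL; rewrite -[c *: f]addr0 lL linear_form0// addr0. Qed.

Lemma linear_formN L f : linear_form L -> L (- f) = - L f.
Proof. by move=> lL; rewrite -scaleN1r linear_formZ// mulN1r. Qed.

Lemma linear_form_scaleC L z (xi : schwartzC R) : linear_form L ->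
  L (scaleC z xi).1 +i* L (scaleC z xi).2 = z * (L xi.1 +i* L xi.2).
Proof.
move=> lL; case: z => x y /=.
by rewrite !linear_formD// linear_formN// !linear_formZ//.
Qed.

Lemma kernel_pair1E L (g : tensor R 1) : linear_form L ->
  kernel_pair (fun xi : 'I_1 -> schwartzC R => L (xi ord0).1 +i* L (xi ord0).2) g =
  L (tensor1_sum g).1 +i* L (tensor1_sum g).2.
Proof.
move=> lL; rewrite /kernel_pair /tensor1_sum.
elim: g => [|c g IHg]; first by rewrite !big_nil/= linear_form0.
rewrite !big_cons IHg -linear_form_scaleC//= !(linear_formD _ _ lL).
by apply/eqP; rewrite eq_complex/= !eqxx.
Qed.

(** The empty tensor has norm 0 and pairs to 0, so 0 is among the values of the supremum. *)
Lemma kernel_norm2_ge0 p n (K : Defs.kernel R n) : (0 <= kernel_norm2 p K)%E.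
Proof.
apply: ereal_sup_ubound; exists [::] => /=.
  by rewrite /tensor_norm2 big_nil ler01.
by rewrite /kernel_pair big_nil Normc.normc0 expr0n.
Qed.

Lemma kernel_norm2_0 p n : kernel_norm2 p (fun _ : 'I_n -> schwartzC R => 0) = 0%E.
Proof.
apply/eqP; rewrite eq_le kernel_norm2_ge0 andbT; apply: ge_ereal_sup.
move=> _ [g _ <-]; rewrite /kernel_pair big1 ?Normc.normc0 ?expr0n//.
by move=> i _; rewrite mulr0.
Qed.

(** For a tensor of order zero both the pairing and the norm depend only on the sum [z] of the
    coefficients: the squared pairing is [a ^+ 2] times |z|^2, and the squared norm is |z|^2. *)
Lemma kernel_norm2_cst a :
  (kernel_norm2 0 (fun _ : 'I_0 -> schwartzC R => a%:C) <= (a ^+ 2)%:E)%E.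
Proof.
apply: ge_ereal_sup => _ [g g1 <-]; rewrite lee_fin.
rewrite /kernel_pair -mulr_suml Normc.normcM exprMn [X in _ * X]normc_sqr/=.
rewrite expr0n addr0 ler_piMl ?sqr_ge0//; move: g1 => /=; apply: le_trans.
rewrite le_eqVlt; apply/orP; left; apply/eqP; set z := \sum_(i <- g) i.1.
transitivity (complex.Re (z * z^*)).
  by rewrite normc_sqr; case: z => x y /=; ring.
congr complex.Re; rewrite {1}/z mulr_suml; apply: eq_bigr => b _.
rewrite rmorph_sum mulr_sumr; apply: eq_bigr => c _.
by rewrite big_ord0 mulr1.
Qed.

(** The squared pairing is the sum of the squares of [L] at the real and imaginary parts of the
    evaluated tensor, and [L2_bounded] applies to each part. *)
Lemma kernel_norm2_linear C L : linear_form L -> L2_bounded C L -> 0 <= C ->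
  (kernel_norm2 0 (fun xi : 'I_1 -> schwartzC R => L (xi ord0).1 +i* L (xi ord0).2)
   <= C%:E)%E.
Proof.
move=> lL bL C0; apply: ge_ereal_sup => _ [g g1 <-]; rewrite lee_fin.
rewrite kernel_pair1E// normc_sqr/=; move: g1 => /=; rewrite tensor1_norm2E.
have := bL (tensor1_sum g).1; have := bL (tensor1_sum g).2.
by set x := ip _ _; set y := ip _ _; nra.
Qed.

(** The exponents [p = q = 0] suffice: the series of kernel norms has at most two nonzero terms,
    both finite. *)
Lemma S1_affine_chaos a C L : linear_form L -> L2_bounded C L ->
  S1 (affine_chaos a L).
Proof.
move=> lL bL; split.
  move=> [|[|n]]; split=> //=.
  - by move=> xi [].
  - move=> xi i z eta zeta; rewrite /subst_arg !ord1 eqxx.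
    rewrite -linear_form_scaleC//= !(linear_formD _ _ lL).
    by apply/eqP; rewrite eq_complex/= !eqxx.
  - by move=> s xi; rewrite !ord1.
  - by move=> xi i z eta zeta; rewrite mulr0 addr0.
(* [kernel_norm2_linear] asks for a nonnegative constant. *)
have bL' : L2_bounded `|C| L.
  move=> psi; apply: (le_trans (bL psi)); apply: ler_wpM2r (ler_norm C).
  exact: ip_ge0.
exists 0%N, 0%N.
rewrite (nneseries_split 0 2); last first.
  by move=> k _; rewrite mule_ge0 ?kernel_norm2_ge0// lee_fin exprn_ge0// invr_ge0.
rewrite eseries0 ?adde0; last first.
  by move=> [|[|n]]// _ _ /=; rewrite kernel_norm2_0 mule0.
rewrite big_nat_recr//= big_nat1 !muln0 !expr0 !mul1e lte_add_pinfty//.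
  exact: le_lt_trans (kernel_norm2_cst a) (ltry _).
exact: le_lt_trans (kernel_norm2_linear lL bL' (normr_ge0 C)) (ltry _).
Qed.

(** The partial sums are constant from [N = 2] on, so the S-transform exists at every [xi], without
    restriction to a neighbourhood of zero. *)
Lemma S_transform_affine a L xi :
  S_transform (affine_chaos a L) xi ((a + L xi.1) +i* L xi.2).
Proof.
split; apply: cvg_near_cst; exists 2%N => // -[|[|n]]// _;
  rewrite (big_cat_nat (n := 2))//= big_nat_recr//= big_nat1 ?add0r.
  by rewrite big1_seq ?addr0// => -[|[|i]] //=; rewrite mem_index_iota.
by rewrite big1_seq ?addr0// => -[|[|i]] //=; rewrite mem_index_iota.
Qed.

Lemma affine_chaosP a L (Phi : chaos R) :
  (forall xi, Phi 0%N xi = a%:C) ->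
  (forall xi, Phi 1%N xi = L (xi ord0).1 +i* L (xi ord0).2) ->
  (forall n xi, Phi n.+2 xi = 0) -> Phi = affine_chaos a L.
Proof.
by move=> P0 P1 P2; apply: functional_extensionality_dep => -[|[|n]];
  apply/funext => xi; rewrite ?P0 ?P1 ?P2.
Qed.

Lemma chaos_constE a : chaos_const a = affine_chaos a (fun _ => 0).
Proof. by apply: affine_chaosP. Qed.

Lemma chaos_scale_affine c a L :
  chaos_scale c (affine_chaos a L) = affine_chaos (c * a) (fun psi => c * L psi).
Proof.
apply: affine_chaosP => [xi|xi|n xi] /=; rewrite /chaos_scale/= ?mulr0//;
by apply/eqP; rewrite eq_complex/=; apply/andP; split; apply/eqP; ring.
Qed.

Lemma linear_formM c L : linear_form L -> linear_form (fun psi => c * L psi).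
Proof. by move=> lL a f g; rewrite lL; ring. Qed.

Lemma L2_boundedZ c C L :
  L2_bounded C L -> L2_bounded (c ^+ 2 * C) (fun psi => c * L psi).
Proof. by move=> bL psi; rewrite exprMn -mulrA ler_wpM2l// sqr_ge0. Qed.

Lemma S1_scale_affine c a C L : linear_form L -> L2_bounded C L ->
  S1 (chaos_scale c (affine_chaos a L)).
Proof.
move=> lL bL; rewrite chaos_scale_affine.
by apply: S1_affine_chaos (L2_boundedZ c bL); exact: linear_formM.
Qed.

Lemma chaos_add_affine a b L M :
  chaos_add (affine_chaos a L) (affine_chaos b M) =
  affine_chaos (a + b) (fun psi => L psi + M psi).
Proof.
apply: affine_chaosP => [xi|xi|n xi] /=; rewrite /chaos_add/= ?addr0//.
by apply/eqP; rewrite eq_complex/= addr0 !eqxx.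
Qed.

End AffineChaos.

(** * The white noise pairing with an L^2 function as a first-order chaos *)

Section Pairing.
Local Open Scope complex_scope.
Variable R : realType.
Notation leb := (@lebesgue_measure R).
Implicit Types (f h : R -> R) (psi : schwartz R).

Definition L2_form h psi : R := \int[leb]_x (h x * psi x).

Lemma integrable_L2_form h psi : sq_integrable leb h ->
  leb.-integrable setT (EFin \o (fun x => h x * psi x)).
Proof. by move=> hh; apply: sq_integrableM => //; exact: sq_integrable_schwartz. Qed.

Lemma linear_L2_form h : sq_integrable leb h -> linear_form (L2_form h).
Proof.
move=> hh a f g; rewrite /L2_form -RintegralZl//; last exact: integrable_L2_form.
rewrite -RintegralD//; last exact: integrable_L2_form.
- by apply: eq_Rintegral => x _; rewrite schwartz_linE mulrDr mulrCA.
- exact: (integrableZl measurableT a (integrable_L2_form f hh)).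
Qed.

Lemma L2_bounded_L2_form h : sq_integrable leb h ->
  L2_bounded (\int[leb]_x (h x ^+ 2)) (L2_form h).
Proof.
by move=> hh psi; apply: cauchy_schwarz => //; exact: sq_integrable_schwartz.
Qed.

(** [f] differs from some approximating Schwartz function by a function of finite L^2 norm, since
    the squared distances are eventually finite. *)
Lemma wn_pairing_sq_integrable mu f Y : wn_pairing mu f Y -> sq_integrable leb f.
Proof.
move=> [mf _ [xi [xif _]]].
have /fine_cvgP[[N _ HN] _] := xif.
have sd : sq_integrable leb (fun x => xi N x - f x).
  apply: sq_integrableP.
    by apply: measurable_funB => //; exact: measurable_schwartz.
  by have := HN N (leqnn N); rewrite /= fin_numElt => /andP[].
have := sq_integrableD (sq_integrable_schwartz (xi N)) (sq_integrableZ (-1) sd).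
by congr (sq_integrable _ _); apply/funext => x; rewrite mulN1r opprB addrC subrK.
Qed.

Lemma wick_limit0 mu n : wick_limit mu (fun _ : 'I_n -> schwartzC R => 0) (fun _ => 0).
Proof.
split; first by split; exact: measurable_cst.
exists (fun _ => [::]); split.
  have -> : (fun eta : 'I_n -> schwartzC R => tensor_kernel [::] eta - 0) = fun _ => 0.
    by apply/funext => eta; rewrite /tensor_kernel big_nil mulr0 subr0.
  by rewrite kernel_norm2_0; exact: cvg_cst.
rewrite /L2dist2 /kernel_pair; under eq_fun do under eq_integral do
  rewrite big_nil subr0 Normc.normc0 expr0n/=.
by rewrite integral0; exact: cvg_cst.
Qed.

Lemma wick1E w (xi : 'I_1 -> schwartzC R) : wick w xi = pairC w (xi ord0).
Proof. by rewrite /= mulr1 subr0. Qed.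

(** The Schwartz functions [xi m] that define the pairing, taken as one-term tensors with zero
    imaginary part, are the smooth kernels required: the distance in L^2(mu) is the given one, and
    the kernel distance is at most the squared L^2 distance of [xi m] to [f]. *)
Lemma wick_limit1 mu f Y : wn_pairing mu f Y ->
  wick_limit mu (affine_chaos 0 (L2_form f) (n:=1%N)) (fun w => (Y w)%:C).
Proof.
move=> fY; have sf := wn_pairing_sq_integrable fY.
case: fY => mf mY [xi [xif xiY]].
split; first by split=> //; exact: measurable_cst.
exists (fun m => [:: (1, fun _ => (xi m, 0))]); split; last first.
  apply: cvg_trans xiY; apply: near_eq_cvg; near=> m.
  apply: eq_integral => w _; congr EFin.
  rewrite normc_sqr /kernel_pair big_seq1 wick1E [_.1 * _]mul1r/=.
  have [lw _] := temperedP w.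
  have -> : wn_pair w 0 = 0.
    by have := lw 1 0 0; rewrite scaler0 addr0 /wn_pair; lra.
  by rewrite subr0 expr0n addr0.
pose d m x := xi m x - f x.
have sd m : sq_integrable leb (d m).
  have := sq_integrableD (sq_integrable_schwartz (xi m)) (sq_integrableZ (-1) sf).
  by congr (sq_integrable _ _); apply/funext => x; rewrite mulN1r.
(* The difference of kernels is the linear form of [d m], so [kernel_norm2_linear] with the constant
   from [L2_bounded_L2_form] gives the upper bound of the squeeze. *)
apply: (@squeeze_cvge _ _ _ _ (cst 0%E) _
  (fun m => \int[leb]_x ((xi m x - f x) ^+ 2)%:E)%E) => //; last exact: cvg_cst.
near=> m; rewrite kernel_norm2_ge0/=.
have -> : (fun eta => tensor_kernel [:: (1, fun _ : 'I_1 => (xi m, 0))] eta -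
    affine_chaos 0 (L2_form f) eta) =
    (fun eta : 'I_1 -> schwartzC R =>
       L2_form (d m) (eta ord0).1 +i* L2_form (d m) (eta ord0).2).
  have E psi : ip (xi m) psi - L2_form f psi = L2_form (d m) psi.
    rewrite /ip /L2_form -RintegralB//.
    - by apply: eq_Rintegral => x _; rewrite -mulrBl.
    - exact: integrable_ip.
    - exact: integrable_L2_form.
  apply/funext => eta; rewrite /tensor_kernel big_seq1/= mul1r.
  have fact1 : 1`! = 1%N by [].
  rewrite fact1 invr1 mul1r.
  rewrite (eq_bigr (fun _ : 'S_1 => dotC (xi m, 0) (eta ord0))); last first.
    by move=> s _; rewrite big_ord_recl big_ord0 mulr1.
  rewrite sumr_const card_Sn fact1 mulr1n dotCE/= !ip0l subr0 addr0 -!E.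
  by [].
have -> : (\int[leb]_x ((xi m x - f x) ^+ 2)%:E)%E =
    (\int[leb]_x (d m x ^+ 2))%:E.
  by rewrite /Rintegral fineK//; apply: integrable_fin_num => //; exact: (sd m).2.
apply: kernel_norm2_linear.
- exact: linear_L2_form.
- exact: L2_bounded_L2_form.
- by apply: Rintegral_ge0 => x _; exact: sqr_ge0.
Unshelve. all: by end_near. Qed.

(** Only order one contributes, so the partial sums equal [Y] from [N = 2] on. *)
Lemma chaos_decomposition_pairing mu f Y : wn_pairing mu f Y ->
  chaos_decomposition mu Y (affine_chaos 0 (L2_form f)).
Proof.
move=> fY; exists (fun n w => if n == 1%N then (Y w)%:C else 0); split.
  move=> [|[|n]] /=.
  - exact: wick_limit0.
  - exact: wick_limit1.
  - exact: wick_limit0.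
apply: cvg_near_cst; exists 2%N => // -[|[|n]]// _.
rewrite /L2dist2 integral0_eq// => w _.
rewrite !big_ord_recl/= add0r big1 ?addr0 ?subrr ?Normc.normc0 ?expr0n//.
Qed.

End Pairing.

(** * The scalar Volterra identity for exponential convolution *)

Section Volterra.
Variables (R : realType) (theta : R).
Hypothesis theta_gt0 : 0 < theta.
Notation leb := (@lebesgue_measure R).
Implicit Types (f : R -> R) (s t : R).

(** The scalar counterpart of the integral in the solution formula. *)
Definition exp_conv f t : R :=
  \int[leb]_(s in `[0, t]) (expR (theta * (s - t)) * f s).

Lemma continuous_exp_tail r :
  continuous (fun s => theta * expR (theta * (r - s))).
Proof.
move=> s; apply: cvgM; first exact: cvg_cst.
apply: continuous_comp; last exact: continuous_expR.
apply: cvgM; first exact: cvg_cst.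
by apply: cvgB; [exact: cvg_cst|exact: cvg_id].
Qed.

(** The antiderivative in [s] is [- expR (theta * (r - s))]. *)
Lemma integral_exp_tail r t : r <= t ->
  (\int[leb]_(s in `[r, t]) (theta * expR (theta * (r - s)))%:E)%E =
  (1 - expR (theta * (r - t)))%:E.
Proof.
rewrite le_eqVlt => /predU1P[->|rt].
  by rewrite set_itv1 integral_set1 subrr mulr0 expR0 subrr.
pose G := fun s => - expR (theta * (r - s)).
have dG s : is_derive s 1 G (theta * expR (theta * (r - s))).
  rewrite /G; apply: is_derive_eq.
  by rewrite /GRing.scale/=; ring.
have cG : continuous G.
  move=> s; apply/differentiable_continuous/derivable1_diffP.
  exact: ex_derive.
rewrite (@continuous_FTC2 _ _ G)//.
- by rewrite /G subrr mulr0 expR0 -EFinB; congr EFin; ring.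
- by apply: continuous_subspaceT; exact: continuous_exp_tail.
- split=> [s _||].
  + exact: ex_derive.
  + by apply: cvg_at_right_filter; exact: cG.
  + by apply: cvg_at_left_filter; exact: cG.
- by move=> s _; rewrite derive1E derive_val.
Qed.

(** * Exchange of integrals over the triangle [0 <= r <= s <= t] *)

Section Triangle.
Variables (f : R -> R) (t : R).
Hypothesis fi : leb.-integrable `[0, t] (EFin \o f).

Let A : set (R * R) := [set p | p.2 <= p.1].

(** The integrand on the triangle, in the coordinates [(s, r)]. It is written with separate cutoffs
    so that measurability follows factor by factor; [GE] is the form used for computing. *)
Let G (p : R * R) : R := \1_A p * (theta * expR (theta * (p.2 - p.1))) *
  \1_(`]-oo, t] : set R) p.1 * (f \_ `[0, t]) p.2.

Let mA : measurable A.
Proof.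
have -> : A = (fun p : R * R => p.1 - p.2) @^-1` `[0, +oo[%classic.
  by apply/seteqP; split=> p /=; rewrite /A/= in_itv/= andbT subr_ge0.
by rewrite -[X in measurable X]setTI; apply: measurable_funB.
Qed.

Let mG : measurable_fun setT G.
Proof.
apply: measurable_funM; last first.
  apply: measurableT_comp => //.
  apply/(measurable_restrictT _ _).1 => //.
  by apply/measurable_EFinP; case/integrableP: fi.
apply: measurable_funM; last exact: measurableT_comp.
apply: measurable_funM => //.
apply: measurable_funM => //; apply: measurableT_comp => //.
by apply: measurable_funM => //; exact: measurable_funB.
Qed.

Let GE s r : G (s, r) = if [&& 0 <= r, r <= s & s <= t]
  then theta * (expR (theta * (r - s)) * f r) else 0.
Proof.
have mem_itv (x : R) (i : interval R) : (x \in [set` i]) = (x \in i).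
  by rewrite mem_setE.
have -> : G (s, r) = ((r <= s)%R : nat)%:R * (theta * expR (theta * (r - s))) *
    ((s <= t)%R : nat)%:R * (if 0 <= r <= t then f r else 0).
  rewrite /G !indicE patchE !mem_itv !in_itv/=; congr (_ %:R * _ * _ * _).
  by congr nat_of_bool; apply/idP/idP => rs; [rewrite inE in rs|rewrite inE].
have [r0|r0] := leP 0 r; last by rewrite mulr0.
have [rs|rs] := leP r s; last by rewrite !mul0r.
have [st|st] := leP s t; last by rewrite mulr0 mul0r.
by rewrite (le_trans rs st)/= !mul1r mulr1 mulrA.
Qed.

Let inner1 s : (\int[leb]_r (G (s, r))%:E)%E =
  (((fun s => theta * exp_conv f s) \_ `[0, t]) s)%:E.
Proof.
rewrite patchE; case: ifPn => [|sN].
  rewrite inE/= in_itv/= => /andP[s0 st].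
  have gi : leb.-integrable `[0, s]
      (EFin \o (fun r => theta * (expR (theta * (r - s)) * f r))).
    have fsi : leb.-integrable `[0, s] (EFin \o f).
      by apply: integrableS fi => //; exact: subset_itvl.
    apply: (le_integrable _ _ _ (integrableZl _ theta fsi)) => //.
      apply/measurable_EFinP; apply: measurable_funM => //.
      apply: measurable_funM; last first.
        by apply/measurable_EFinP; case/integrableP: fsi.
      apply: measurable_funTS; apply: measurableT_comp => //.
      by apply: measurable_funM => //; exact: measurable_funB.
    move=> r /=; rewrite in_itv/= => /andP[r0 rs].
    rewrite lee_fin !normrM ler_wpM2l// ler_piMl//.
    by rewrite ger0_norm ?expR_ge0// expR_le1 pmulr_rle0// subr_le0.
  rewrite /exp_conv -RintegralZl//; last first.
    apply: eq_integrable (integrableZl _ theta^-1 gi) => // r _ /=.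
    by rewrite -EFinM mulKf// gt_eqF.
  rewrite /Rintegral fineK; last exact: integrable_fin_num.
  rewrite [RHS]integral_mkcond; apply: eq_integral => r _.
  rewrite GE patchE mem_setE in_itv/= st andbT.
  by case: ifP.
rewrite integral0_eq// => r _; rewrite GE; case: ifP => // /and3P[r0 rs st].
by move: sN; rewrite mem_setE in_itv/= (le_trans r0 rs) st.
Qed.

(** Stated for an arbitrary [h] because it serves twice: with [h] the absolute value of [f] for
    integrability, and with [f] itself for the exchange. *)
Let inner2 (h : R -> R) r :
  (\int[leb]_s (if [&& 0%R <= r, r <= s & s <= t]
     then theta * (expR (theta * (r - s)) * h r) else 0)%:E)%E =
  (((fun r => (1 - expR (theta * (r - t))) * h r) \_ `[0, t]) r)%:E.
Proof.
rewrite patchE mem_setE in_itv/=; case: ifPn => [/andP[r0 rt]|rN].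
  transitivity (\int[leb]_(s in `[r, t])
      ((h r)%:E * (theta * expR (theta * (r - s)))%:E))%E.
    rewrite [RHS]integral_mkcond; apply: eq_integral => s _.
    rewrite patchE mem_setE in_itv/= r0/=; case: ifP => // _.
    by rewrite -EFinM; congr EFin; ring.
  rewrite integralZl//.
    by rewrite integral_exp_tail// -EFinM mulrC.
  apply: continuous_compact_integrable; first exact: segment_compact.
  apply: continuous_subspaceT; exact: continuous_exp_tail.
rewrite integral0_eq// => s _; case: ifP => // /and3P[r0 rs st].
by move: rN; rewrite r0 (le_trans rs st).
Qed.

Let integrable_tail (h : R -> R) : leb.-integrable `[0, t] (EFin \o h) ->
  leb.-integrable `[0, t] (EFin \o (fun r => (1 - expR (theta * (r - t))) * h r)).
Proof.
move=> hi; apply: (le_integrable _ _ _ hi) => //.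
  apply/measurable_EFinP; apply: measurable_funM; last first.
    by apply/measurable_EFinP; case/integrableP: hi.
  apply: measurable_funTS; apply: measurable_funB => //; apply: measurableT_comp => //.
  by apply: measurable_funM => //; exact: measurable_funB.
move=> r /=; rewrite in_itv/= => /andP[r0 rt].
rewrite lee_fin !normrM ler_piMl//.
have := expR_ge0 (theta * (r - t)).
have : expR (theta * (r - t)) <= 1 by rewrite expR_le1 pmulr_rle0// subr_le0.
by move=> ? ?; rewrite ger0_norm; lra.
Qed.

(** Tonelli, integrating in [s] first: the inner integral of the absolute value is
    [1 - expR (theta * (r - t))], a factor in [0, 1], times the absolute value of [f r]. *)
Let Gi : (leb \x leb)%E.-integrable setT (EFin \o G).
Proof.
apply/integrable21ltyP; first exact/measurable_EFinP.
have fi' := integrable_norm fi.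
have /integrableP[_] := integrable_tail fi'; apply: le_lt_trans.
rewrite [leRHS]integral_mkcond; rewrite le_eqVlt; apply/orP; left; apply/eqP.
apply: eq_integral => r _.
transitivity (\int[leb]_s (if [&& 0%R <= r, r <= s & s <= t]
     then theta * (expR (theta * (r - s)) * `|f r|) else 0)%:E)%E.
  apply: eq_integral => s _; rewrite /= GE; congr EFin.
  case: ifP => _; last by rewrite normr0.
  by rewrite !normrM (gtr0_norm theta_gt0) (ger0_norm (expR_ge0 _)).
rewrite (inner2 (fun x => `|f x|)) !patchE; case: ifP => //; rewrite mem_setE in_itv/=.
move=> /andP[r0 rt]; rewrite normrM normr_id ger0_norm// subr_ge0.
by rewrite expR_le1 pmulr_rle0// subr_le0.
Qed.

Lemma integrable_exp_conv : leb.-integrable `[0, t] (EFin \o exp_conv f).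
Proof.
have /(integrableZl measurableT theta^-1) := integrable_fubini_F Gi.
rewrite /fubini_F /=; under eq_fun do rewrite inner1 -EFinM.
move=> H; apply/integrable_mkcond => //; apply: eq_integrable H => // s _.
rewrite !patchE; case: ifP => _; last by rewrite mulr0.
by rewrite mulKf// gt_eqF.
Qed.

(** Exchanging the integrals turns the [theta * exp_conv] part into the integral of
    [(1 - expR (theta * (r - t))) * f r]; subtracted from the integral of [f], it leaves exactly the
    exponential weight. *)
Lemma exp_convE : \int[leb]_(s in `[0, t]) (f s - theta * exp_conv f s) = exp_conv f t.
Proof.
have ei := integrable_exp_conv.
rewrite RintegralB//; last exact: (integrableZl _ theta ei).
have -> : \int[leb]_(s in `[0, t]) (theta * exp_conv f s) =
    \int[leb]_(r in `[0, t]) ((1 - expR (theta * (r - t))) * f r).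
  rewrite [LHS]Rintegral_mkcond [RHS]Rintegral_mkcond /Rintegral; congr fine.
  under eq_integral do rewrite -inner1.
  under [in RHS]eq_integral do rewrite -inner2.
  rewrite (Fubini Gi); apply: eq_integral => r _; apply: eq_integral => s _.
  by rewrite /= GE.
rewrite -RintegralB//; last exact: integrable_tail.
by apply: eq_Rintegral => s _; ring.
Qed.

End Triangle.

End Volterra.

(** * The integral equation for an abstract family of first-order kernels [L t] *)

Section OrnsteinUhlenbeck.
Local Open Scope complex_scope.
Variables (R : realType) (theta sigma u0 : R).
Hypothesis theta_gt0 : 0 < theta.
Notation leb := (@lebesgue_measure R).
Implicit Types (psi : schwartz R) (s t : R).

Variable L : R -> schwartz R -> R.
Hypothesis linL : forall t, 0 <= t -> linear_form (L t).
Hypothesis bndL : forall t, 0 <= t ->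
  exists C, forall s, 0 <= s <= t -> L2_bounded C (L s).
Hypothesis measL : forall t psi, 0 <= t ->
  measurable_fun (`[0, t] : set R) (fun s => L s psi).

Let Xi t := affine_chaos 0 (L t).
Let j t psi := exp_conv theta (fun s => L s psi) t.
Let J t := affine_chaos 0 (j t).

Let boundL t psi : 0 <= t -> exists2 C, 0 <= C &
  forall s, 0 <= s <= t -> `|L s psi| <= Num.sqrt (C * ip psi psi).
Proof.
move=> t0; have [C HC] := bndL t0; exists `|C| => // s st.
rewrite -sqrtr_sqr ler_wsqrtr//; apply: le_trans (HC s st psi) _.
by rewrite ler_wpM2r ?ip_ge0 ?ler_norm.
Qed.

Let integrableL t psi : 0 <= t -> leb.-integrable `[0, t] (EFin \o (L^~ psi)).
Proof.
move=> t0; apply: measurable_bounded_integrable => //.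
- by rewrite /= lebesgue_measure_itv/=; case: ifP => //; rewrite -EFinB ltry.
- exact: measL.
- have [C C0 HC] := boundL psi t0; exists (Num.sqrt (C * ip psi psi)).
  split; first exact: num_real.
  move=> M CM s /=; rewrite in_itv/= => st; exact: le_trans (HC s st) (ltW CM).
Qed.

Let integrable_expL t psi : 0 <= t ->
  leb.-integrable `[0, t] (EFin \o (fun s => expR (theta * (s - t)) * L s psi)).
Proof.
move=> t0; apply: (le_integrable _ _ _ (integrableL psi t0)) => //.
  apply/measurable_EFinP; apply: measurable_funM; last exact: measL.
  apply: measurable_funTS; apply: measurableT_comp => //.
  by apply: measurable_funM => //; exact: measurable_funB.
move=> s /=; rewrite in_itv/= => /andP[s0 st].
rewrite lee_fin normrM ler_piMl// ger0_norm ?expR_ge0//.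
by rewrite expR_le1 pmulr_rle0// subr_le0.
Qed.

Let lin_j t : 0 <= t -> linear_form (j t).
Proof.
move=> t0 a f g; rewrite /j /exp_conv -RintegralZl//; last exact: integrable_expL.
rewrite -RintegralD//; last exact: integrable_expL.
- apply: eq_Rintegral => s; rewrite inE/= in_itv/= => /andP[s0 st].
  by rewrite linL//; ring.
- exact: (integrableZl _ a (integrable_expL f t0)).
Qed.

(** The exponential weight is at most 1 on [[0, t]], so the integral is at most [t] times the
    uniform bound on [L s psi]; squaring produces the factor [t ^+ 2]. *)
Let bnd_j t : 0 <= t -> exists C, L2_bounded C (j t).
Proof.
move=> t0; have [C HC] := bndL t0; exists (t ^+ 2 * C) => psi.
(* The sign of [C] is unknown, but this product bounds the square of [L 0 psi]. *)
have K0 : 0 <= C * ip psi psi.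
  by apply: le_trans (HC 0 _ psi); rewrite ?sqr_ge0// lexx.
have HL s : 0 <= s <= t -> `|L s psi| <= Num.sqrt (C * ip psi psi).
  by move=> st; rewrite -sqrtr_sqr ler_wsqrtr// HC.
suff H : `|j t psi| <= t * Num.sqrt (C * ip psi psi).
  rewrite -mulrA -[C * _]sqr_sqrtr// -exprMn -(real_normK (num_real (j t psi))).
  by rewrite ler_pXn2r// nnegrE mulr_ge0// sqrtr_ge0.
rewrite /j /exp_conv.
apply: le_trans (le_normr_Rintegral _ (integrable_expL psi t0)) _ => //.
have : \int[leb]_(s in `[0, t]) (Num.sqrt (C * ip psi psi)) =
    t * Num.sqrt (C * ip psi psi).
  rewrite Rintegral_cst//= mulrC lebesgue_measure_itv/= lte_fin.
  move: t0; rewrite le_eqVlt => /predU1P[<-|t0]; first by rewrite ltxx.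
  by rewrite t0/= subr0.
move=> <-; apply: le_Rintegral => //.
- exact: integrable_norm (integrable_expL psi t0).
- apply: measurable_bounded_integrable => //.
    by rewrite /= lebesgue_measure_itv/=; case: ifP => //; rewrite -EFinB ltry.
  exists (Num.sqrt (C * ip psi psi)); split; first exact: num_real.
  by move=> M CM s _ /=; rewrite ger0_norm ?sqrtr_ge0// ltW.
- move=> s /=; rewrite in_itv/= => /[dup] st /andP[s0 st'].
  apply: le_trans (HL s st); rewrite normrM ler_piMl// ger0_norm ?expR_ge0//.
  by rewrite expR_le1 pmulr_rle0// subr_le0.
Qed.

Let S1_Xi t : 0 <= t -> S1 (Xi t).
Proof.
move=> t0; have [C HC] := bndL t0; apply: S1_affine_chaos; first exact: linL.
by apply: HC; rewrite t0 lexx.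
Qed.

Let S1_J t : 0 <= t -> S1 (J t).
Proof.
move=> t0; have [C HC] := bnd_j t0; apply: S1_affine_chaos HC; exact: lin_j.
Qed.

(** The S-transform of an affine chaos is affine in its kernel, so integrating the S-transforms
    amounts to integrating the kernels at the real and imaginary parts of [xi]. *)
Lemma S1_integral_J t : 0 <= t ->
  S1_integral t (fun s => chaos_scale (expR (theta * (s - t))) (Xi s)) (J t).
Proof.
move=> t0; split.
- move=> s /[dup] st /andP[s0 _]; have [C HC] := bndL t0.
  by apply: S1_scale_affine (HC s st); exact: linL.
- exact: S1_J.
- exists 0%N, 0%N => xi _.
  exists (fun s => (expR (theta * (s - t)) * L s xi.1) +i*
                   (expR (theta * (s - t)) * L s xi.2)); split.
  + move=> s _; rewrite chaos_scale_affine.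
    by have := S_transform_affine (expR (theta * (s - t)) * 0)
      (fun psi => expR (theta * (s - t)) * L s psi) xi; rewrite mulr0 add0r.
  + exact: integrable_expL.
  + exact: integrable_expL.
  + by have := S_transform_affine 0 (j t) xi; rewrite add0r.
Qed.

Let U t := chaos_add (chaos_const (u0 * expR (- (theta * t))))
            (chaos_add (chaos_scale sigma (Xi t))
                       (chaos_scale (- (sigma * theta)) (J t))).

Let UE t : U t = affine_chaos (u0 * expR (- (theta * t)))
  (fun psi => sigma * (L t psi - theta * j t psi)).
Proof.
rewrite /U /Xi /J chaos_constE !chaos_scale_affine !chaos_add_affine !mulr0 !addr0.
by congr affine_chaos; apply/funext => psi; ring.
Qed.

Let S1_U t : 0 <= t -> S1 (U t).
Proof.
move=> t0; rewrite UE; have [C HC] := bndL t0; have [D HD] := bnd_j t0.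
(* The constant comes from [(x - theta * y) ^+ 2 <= 2 * (x ^+ 2 + theta ^+ 2 * y ^+ 2)] and the
   separate bounds [C] for [x] and [D] for [y]. *)
apply: (@S1_affine_chaos _ _ (2 * sigma ^+ 2 * (C + theta ^+ 2 * D))).
  by move=> a f g; rewrite linL// lin_j//; ring.
move=> psi.
have := HC t _ psi; rewrite t0 lexx => /(_ isT); have := HD psi.
set x := L t psi; set y := j t psi; set p := ip _ _ => H1 H2.
apply: (@le_trans _ _ (2 * sigma ^+ 2 * (x ^+ 2 + theta ^+ 2 * y ^+ 2))).
  rewrite exprMn [leRHS](_ : _ = sigma ^+ 2 * (2 * (x ^+ 2 + theta ^+ 2 * y ^+ 2)));
    last by ring.
  rewrite ler_wpM2l ?sqr_ge0//.
  by have := sqr_ge0 (x + theta * y); nra.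
rewrite -[leRHS]mulrA; apply: ler_wpM2l; first by rewrite mulr_ge0 ?sqr_ge0.
by rewrite mulrDl lerD// -mulrA ler_wpM2l ?sqr_ge0.
Qed.

Let integrable_exp t : 0 <= t ->
  leb.-integrable `[0, t] (EFin \o (fun s => u0 * expR (- (theta * s)))).
Proof.
move=> t0; apply: continuous_compact_integrable; first exact: segment_compact.
apply: continuous_subspaceT => s; apply: cvgM; first exact: cvg_cst.
apply: continuous_comp; last exact: continuous_expR.
by apply: cvgN; apply: cvgM; [exact: cvg_cst|exact: cvg_id].
Qed.

Let integral_exp t : 0 <= t -> \int[leb]_(s in `[0, t]) (u0 * expR (- (theta * s))) =
  u0 * (1 - expR (- (theta * t))) / theta.
Proof.
move=> t0.
(* This rewrites the integrand as the case [r = 0] of [integral_exp_tail]. *)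
have E s : u0 * expR (- (theta * s)) = u0 / theta * (theta * expR (theta * (0 - s))).
  by rewrite sub0r mulrN; field; rewrite gt_eqF.
under eq_Rintegral do rewrite E.
rewrite RintegralZl//.
  rewrite /Rintegral integral_exp_tail//= sub0r mulrN.
  by field; rewrite gt_eqF.
apply: continuous_compact_integrable; first exact: segment_compact.
by apply: continuous_subspaceT; exact: continuous_exp_tail.
Qed.

Let integrable_UL t psi : 0 <= t -> leb.-integrable `[0, t]
  (EFin \o (fun s => sigma * (L s psi - theta * j s psi))).
Proof.
move=> t0; have Li := integrableL psi t0.
have ji := integrable_exp_conv theta_gt0 Li.
exact: (integrableZl _ sigma (integrableB _ Li (integrableZl _ theta ji))).
Qed.

Let integral_UL t psi : 0 <= t ->
  \int[leb]_(s in `[0, t]) (sigma * (L s psi - theta * j s psi)) = sigma * j t psi.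
Proof.
move=> t0; have Li := integrableL psi t0.
have ji := integrable_exp_conv theta_gt0 Li.
rewrite RintegralZl//; last exact: (integrableB _ Li (integrableZl _ theta ji)).
by rewrite exp_convE.
Qed.

Lemma U_solution t : 0 <= t -> S1 (U t) /\
  exists2 I : chaos R, S1_integral t U I &
    U t = chaos_add (chaos_const u0)
            (chaos_add (chaos_scale (- theta) I) (chaos_scale sigma (Xi t))).
Proof.
move=> t0; split; first exact: S1_U.
(* The witness is the integral of [U] component by component: order zero by [integral_exp], order
   one by [integral_UL], where [exp_convE] reduces the kernel to [sigma * j t]. *)
exists (affine_chaos (u0 * (1 - expR (- (theta * t))) / theta)
         (fun psi => sigma * j t psi)).
  split.
  - by move=> s /andP[s0 _]; exact: S1_U.
  - have [C HC] := bnd_j t0.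
    by apply: S1_affine_chaos (L2_boundedZ sigma HC); apply: linear_formM; exact: lin_j.
  - exists 0%N, 0%N => xi _.
    exists (fun s => (u0 * expR (- (theta * s)) +
                        sigma * (L s xi.1 - theta * j s xi.1)) +i*
                     (sigma * (L s xi.2 - theta * j s xi.2))); split.
    + by move=> s _; rewrite UE; exact: S_transform_affine.
    + exact: (integrableD _ (integrable_exp t0) (integrable_UL xi.1 t0)).
    + exact: integrable_UL.
    + rewrite /= RintegralD//.
      * by rewrite integral_exp// !integral_UL//; exact: S_transform_affine.
      * exact: integrable_exp.
      * exact: integrable_UL.
rewrite UE /Xi chaos_constE !chaos_scale_affine !chaos_add_affine.
congr affine_chaos; first by field; rewrite gt_eqF.
by apply/funext => psi; ring.
Qed.

Lemma OU_solution : exists J' : R -> chaos R,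
  (forall t, 0 <= t -> S1 (Xi t)) /\
  (forall t, 0 <= t ->
     S1_integral t (fun s => chaos_scale (expR (theta * (s - t))) (Xi s)) (J' t)) /\
  let U := fun t : R =>
          chaos_add (chaos_const (u0 * expR (- (theta * t))))
            (chaos_add (chaos_scale sigma (Xi t))
                       (chaos_scale (- (sigma * theta)) (J' t))) in
  forall t, 0 <= t -> S1 (U t) /\
    exists2 I : chaos R, S1_integral t U I &
      U t = chaos_add (chaos_const u0)
            (chaos_add (chaos_scale (- theta) I) (chaos_scale sigma (Xi t))).
Proof.
exists J; split; first exact: S1_Xi.
split; first exact: S1_integral_J.
exact: U_solution.
Qed.

End OrnsteinUhlenbeck.

(** * Measurability in the parameter of integrals of a monotone family *)

Section MonotoneFamily.
Variable R : realType.
Notation leb := (@lebesgue_measure R).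

(** Against a nonnegative weight the integral is nondecreasing in [s], hence measurable; a general
    weight [w] is the difference of its positive and negative parts. *)
Lemma measurable_monotone_family (r : R -> R -> R) (w : R -> R) (t : R) :
  (forall s, 0 <= s -> measurable_fun setT (r s)) ->
  measurable_fun setT w ->
  (forall s, 0 <= s -> leb.-integrable setT (EFin \o (fun x => r s x * w x))) ->
  (forall s s' x, 0 <= s -> s <= s' -> 0 <= r s x <= r s' x) ->
  measurable_fun (`[0, t] : set R) (fun s => \int[leb]_x (r s x * w x)).
Proof.
move=> mr mw rwi rmono.
have part (v : R -> R) : measurable_fun setT v -> (forall x, 0 <= v x <= `|w x|) ->
    (forall s, 0 <= s -> leb.-integrable setT (EFin \o (fun x => r s x * v x))) /\
    measurable_fun (`[0, t] : set R) (fun s => \int[leb]_x (r s x * v x)).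
  move=> mv vw.
  have rvi s : 0 <= s -> leb.-integrable setT (EFin \o (fun x => r s x * v x)).
    move=> s0; apply: (le_integrable measurableT _ _ (rwi s s0)).
      by apply/measurable_EFinP; apply: measurable_funM => //; exact: mr.
    move=> x _ /=; rewrite lee_fin !normrM ler_wpM2l//.
    by case/andP: (vw x) => v0; rewrite (ger0_norm v0).
  split=> //.
  (* Monotonicity is assumed for [0 <= s] only; replacing [s] by [Num.max 0 s] gives a function
     monotone on the whole line that agrees with the original on [[0, t]]. *)
  have : measurable_fun (`[0, t] : set R)
      (fun s => \int[leb]_x (r (Num.max 0 s) x * v x)).
    apply: nondecreasing_measurable => // s s' ss'.
    have m0 : 0 <= Num.max 0 s by rewrite le_max lexx.
    have m0' : 0 <= Num.max 0 s' by rewrite le_max lexx.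
    apply: le_Rintegral => //; [exact: rvi|exact: rvi|move=> x _].
    have [v0 _] := andP (vw x); apply: ler_wpM2r => //.
    have : Num.max 0 s <= Num.max 0 s' by rewrite ge_max !le_max lexx ss' orbT.
    by move=> /(rmono _ _ x m0)/andP[].
  apply: eq_measurable_fun => s; rewrite inE/= in_itv/= => /andP[s0 _].
  by rewrite max_r.
pose wp x := Num.max (w x) 0; pose wn x := Num.max (- w x) 0.
have [pi mp] : (forall s, 0 <= s ->
      leb.-integrable setT (EFin \o (fun x => r s x * wp x))) /\
    measurable_fun (`[0, t] : set R) (fun s => \int[leb]_x (r s x * wp x)).
  apply: part; first exact: measurable_maxr.
  by move=> x; rewrite /wp le_max lexx orbT/= ge_max ler_norm normr_ge0.
have [ni mn] : (forall s, 0 <= s ->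
      leb.-integrable setT (EFin \o (fun x => r s x * wn x))) /\
    measurable_fun (`[0, t] : set R) (fun s => \int[leb]_x (r s x * wn x)).
  apply: part; first by apply: measurable_maxr => //; exact: measurableT_comp.
  by move=> x; rewrite /wn le_max lexx orbT/= ge_max -normrN ler_norm normr_ge0.
have : measurable_fun (`[0, t] : set R)
  (fun s => \int[leb]_x (r s x * wp x) - \int[leb]_x (r s x * wn x)).
  exact: measurable_funB.
apply: eq_measurable_fun => s; rewrite inE/= in_itv/= => /andP[s0 _].
rewrite -RintegralB//; [|exact: pi|exact: ni].
apply: eq_Rintegral => x _; rewrite -mulrBr /wp /wn; congr (_ * _).
have [w0|w0] := leP 0 (w x).
  by rewrite max_r ?oppr_le0// subr0.
by rewrite max_l ?oppr_ge0 ?ltW// sub0r opprK.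
Qed.

End MonotoneFamily.

Section RightConv.
Variable R : realType.
Notation leb := (@lebesgue_measure R).
Variable k : R -> R.
Hypothesis k_ge0 : forall x, 0 < x -> 0 <= k x.
Hypothesis k_noninc : forall x y, 0 < x -> x <= y -> k y <= k x.
Hypothesis k_int : forall a, 0 < a -> leb.-integrable `]0, a] (EFin \o k).

(** The hypotheses constrain [k] on (0, +oo) only; cutting it off there allows integrals over the
    whole line. *)
Definition zero_ext (x : R) : R := if 0 < x then k x else 0.

(** [k \o expR] is nonincreasing on the whole line, hence measurable; composing with [ln] recovers
    [k] on the half-line. *)
Lemma measurable_noninc : measurable_fun (`]0, +oo[ : set R) k.
Proof.
have mk : measurable_fun setT (k \o expR).
  apply: nonincreasing_measurable => // x y xy /=.
  by apply: k_noninc; rewrite ?expR_gt0// ler_expR.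
have : measurable_fun (`]0, +oo[ : set R) ((k \o expR) \o (@ln R)).
  apply: measurableT_comp => //; exact: measurable_funTS.
apply: eq_measurable_fun => x; rewrite inE/= in_itv/= andbT => x0.
by rewrite lnK.
Qed.

Lemma zero_extE : zero_ext = k \_ `]0, +oo[.
Proof.
by apply/funext => x; rewrite patchE mem_setE in_itv/= andbT.
Qed.

Lemma measurable_zero_ext : measurable_fun setT zero_ext.
Proof.
by rewrite zero_extE; apply/(measurable_restrictT _ _).1 => //; exact: measurable_noninc.
Qed.

Lemma zero_ext_ge0 x : 0 <= zero_ext x.
Proof. by rewrite /zero_ext; case: ifPn => // x0; exact: k_ge0. Qed.

(** The substitution [v = t - x] leaves [s] and [x] in the indicator alone, which makes monotonicity
    in [s] and measurability in [x] visible. *)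
Lemma right_convE s x : right_conv k \1_(`[0, s[) x =
  \int[leb]_v (\1_(`[0, s[) (v + x) * zero_ext v).
Proof.
rewrite /right_conv Rintegral_mkcond /Rintegral; congr fine.
rewrite -(ge0_integral_shift (- x)
  (f := fun v => (\1_(`[0, s[) (v + x) * zero_ext v)%:E)).
- apply: eq_integral => u _; rewrite patchE mem_setE in_itv/= andbT.
  rewrite subrK /zero_ext subr_gt0; case: ifP => //.
  by rewrite mulr0.
- apply/measurable_EFinP; apply: measurable_funM; last exact: measurable_zero_ext.
  apply: measurableT_comp => //; exact: measurable_funD.
- by move=> v; rewrite lee_fin mulr_ge0// zero_ext_ge0.
Qed.

Lemma indic_itvE s (x : R) : \1_(`[0, s[ : set R) x = ((0 <= x < s)%R : nat)%:R :> R.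
Proof. by rewrite indicE mem_setE in_itv. Qed.

Lemma integrable_right_conv s x :
  leb.-integrable setT (EFin \o (fun v => \1_(`[0, s[) (v + x) * zero_ext v)).
Proof.
(* The indicator vanishes for [v >= s - x], so only []0, a]] matters; the maximum with 1 keeps [a]
   positive. *)
pose a := Num.max 1 (s - x).
have a0 : 0 < a by rewrite lt_max ltr01.
have ki := integrable_patch (measurable_itv `]0, a]) (k_int a0).
apply: (le_integrable measurableT _ _ ki).
  apply/measurable_EFinP; apply: measurable_funM; last exact: measurable_zero_ext.
  apply: measurableT_comp => //; exact: measurable_funD.
move=> v _; rewrite /= patchE mem_setE in_itv/= indic_itvE /zero_ext.
have [v0|v0] := ltP 0 v; last by rewrite mulr0 normr0.
have [va|va] /= := leP v a.
  rewrite lee_fin normrM ler_piMl//.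
  by case: (_ && _); rewrite ?normr1 ?normr0.
have -> : (v + x < s) = false.
  by apply/negbTE; rewrite -leNgt; move: va; rewrite /a gt_max => /andP[_]; lra.
by rewrite andbF mul0r normr0.
Qed.

Lemma right_conv_ge0 s x : 0 <= right_conv k \1_(`[0, s[) x.
Proof.
by rewrite right_convE; apply: Rintegral_ge0 => v _; rewrite mulr_ge0// zero_ext_ge0.
Qed.

Lemma right_conv_nondecr s s' x : s <= s' ->
  right_conv k \1_(`[0, s[) x <= right_conv k \1_(`[0, s'[) x.
Proof.
move=> ss'; rewrite !right_convE; apply: le_Rintegral => //.
- exact: integrable_right_conv.
- exact: integrable_right_conv.
- move=> v _; apply: ler_wpM2r; first exact: zero_ext_ge0.
  rewrite !indic_itvE ler_nat; have [vx|//] := leP 0 (v + x).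
  by have [vs|//] := ltP (v + x) s; rewrite (lt_le_trans vs ss').
Qed.

(** The function is a partial integral of a nonnegative jointly measurable integrand, so Tonelli
    gives its measurability. *)
Lemma measurable_right_conv s : measurable_fun setT (right_conv k \1_(`[0, s[)).
Proof.
pose H (p : R * R) := (\1_(`[0, s[ : set R) (p.2 + p.1) * zero_ext p.2)%:E : \bar R.
have mH : measurable_fun setT H.
  apply/measurable_EFinP; apply: measurable_funM.
    by apply: measurableT_comp => //; exact: measurable_funD.
  by apply: measurableT_comp => //; exact: measurable_zero_ext.
have H0 p : (0 <= H p)%E by rewrite lee_fin mulr_ge0// zero_ext_ge0.
have mF : measurable_fun setT (fubini_F leb H).
  exact: measurable_fun_fubini_tonelli_F.
have -> : right_conv k \1_(`[0, s[) = fine \o fubini_F leb H.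
  by apply/funext => x; rewrite right_convE.
by apply: measurableT_comp.
Qed.

End RightConv.

(** * The weak derivative of [rc s] and its L^2 bound, uniform for bounded [s] *)

Section WeakDerivative.
Variable R : realType.
Notation leb := (@lebesgue_measure R).
Variable k : R -> R.
Hypothesis k_ge0 : forall x, 0 < x -> 0 <= k x.
Hypothesis k_noninc : forall x y, 0 < x -> x <= y -> k y <= k x.
Hypothesis k_int : forall a, 0 < a -> leb.-integrable `]0, a] (EFin \o k).
Implicit Types (psi : schwartz R) (s t : R).

Notation rc s := (right_conv k \1_(`[0, s[)).
Notation kt := (zero_ext k).

(** Splitting at 1 separates the integrable singularity at 0 from a part bounded by [k 1]. *)
Lemma zero_ext_le v : kt v <= (k \_ `]0, 1]) v + k 1.
Proof.
rewrite patchE mem_setE in_itv/= /zero_ext; have [v0|v0] /= := ltP 0 v; last first.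
  by rewrite add0r k_ge0.
have [v1|v1] := leP v 1; first by rewrite lerDl k_ge0.
by rewrite add0r k_noninc// ltW.
Qed.

Lemma right_conv_bounded s : exists2 C, 0 <= C & forall x, `|rc s x| <= C.
Proof.
have ki := integrable_patch (measurable_itv `]0, 1]) (k_int ltr01).
have k10 : 0 <= k 1 by exact: k_ge0.
(* The two terms of [zero_ext_le] contribute separately: the singular part its whole integral, and
   [k 1] times the length of the translated interval. *)
pose C := \int[leb]_v ((k \_ `]0, 1]) v) + k 1 * `|s|.
have Cx x : `|rc s x| <= C.
  rewrite ger0_norm ?right_conv_ge0// right_convE//.
  have ii : leb.-integrable setT (EFin \o (fun v => \1_(`[0, s[ : set R) (v + x))).
    exact: (integrable_shift x (integrable_indic_itv 0 s true true)).
  have les : \int[leb]_v (\1_(`[0, s[ : set R) (v + x)) <= `|s|.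
    rewrite (Rintegral_shift x (integrable_indic_itv 0 s true true)).
    rewrite /Rintegral integral_indic// setIT/= lebesgue_measure_itv/= lte_fin.
    by case: ifP => //= s0; rewrite subr0 ler_norm.
  apply: (@le_trans _ _ (\int[leb]_v ((k \_ `]0, 1]) v +
      k 1 * (\1_(`[0, s[ : set R) (v + x))))).
    apply: le_Rintegral => //.
    - exact: integrable_right_conv.
    - exact: (integrableD measurableT ki (integrableZl measurableT (k 1) ii)).
    - move=> v _; rewrite indic_itvE; case: (_ && _); last first.
        rewrite mul0r mulr0 addr0 patchE mem_setE in_itv/=; case: ifP => // /andP[v0 _].
        exact: k_ge0.
      by rewrite mul1r mulr1 zero_ext_le.
  rewrite RintegralD//; last exact: (integrableZl measurableT (k 1) ii).
  by rewrite RintegralZl// lerD2l ler_wpM2l.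
exists C => //; exact: le_trans (normr_ge0 _) (Cx 0).
Qed.

Lemma integrable_right_convM s psi :
  leb.-integrable setT (EFin \o (fun x => rc s x * psi x)).
Proof.
have [C C0 HC] := right_conv_bounded s.
apply: (le_integrable measurableT _ _
  (integrableZl measurableT C (integrable_schwartz psi))).
  apply/measurable_EFinP; apply: measurable_funM.
    exact: measurable_right_conv.
  exact: measurable_schwartz.
move=> x _ /=; rewrite lee_fin !normrM (ger0_norm C0) ler_wpM2r//.
Qed.

(** Near 0 the kernel is integrable and [g] is bounded; beyond 1 the kernel is bounded and [g] is
    integrable. *)
Lemma integrable_zero_extM (g : R -> R) (B : R) : (forall x, `|g x| <= B) ->
  leb.-integrable setT (EFin \o g) ->
  leb.-integrable setT (EFin \o (fun v => kt v * g v)).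
Proof.
move=> gB gi.
have ki := integrable_patch (measurable_itv `]0, 1]) (k_int ltr01).
have /integrableP[/measurable_EFinP mg _] := gi.
have i2 := integrableZl measurableT (k 1) (integrable_norm gi).
apply: (le_integrable measurableT _ _
  (integrableD measurableT (integrableZl measurableT B ki) i2)).
  by apply/measurable_EFinP; apply: measurable_funM => //; exact: measurable_zero_ext.
move=> v _ /=; rewrite lee_fin.
have p0 : 0 <= (k \_ `]0, 1]) v.
  rewrite patchE mem_setE in_itv/=; case: ifP => // /andP[v0 _]; exact: k_ge0.
have k10 : 0 <= k 1 by exact: k_ge0.
have B0 : 0 <= B by exact: le_trans (gB 0).
rewrite [leRHS]ger0_norm ?addr_ge0 ?mulr_ge0//.
rewrite normrM (ger0_norm (zero_ext_ge0 k_ge0 _)).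
apply: (@le_trans _ _ (((k \_ `]0, 1]) v + k 1) * `|g v|)).
  by rewrite ler_wpM2r// zero_ext_le.
by rewrite mulrDl lerD// mulrC ler_wpM2r.
Qed.

Lemma integral_derive_schwartz psi a b : a <= b ->
  (\int[leb]_(x in `[a, b[) (derive1 psi x)%:E = (psi b - psi a)%:E)%E.
Proof.
rewrite le_eqVlt => /predU1P[->|ab].
  by rewrite set_itvco0 integral_set0 subrr.
rewrite integral_itv_bndo_bndc; last first.
  apply/measurable_EFinP; apply: measurable_funTS.
  exact: (measurable_schwartz (derive_schwartz psi)).
rewrite (@continuous_FTC2 _ _ psi)//.
- apply: continuous_subspaceT => x.
  exact: (@continuous_schwartz R (derive_schwartz psi)).
- split=> [x _||].
  + exact: derivable_schwartz.
  + by apply: cvg_at_right_filter; exact: continuous_schwartz.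
  + by apply: cvg_at_left_filter; exact: continuous_schwartz.
Qed.

(** Fubini: for fixed [v] the indicator restricts [x] to [[- v, s - v[], where the fundamental
    theorem of calculus integrates [derive1 psi]. *)
Lemma right_conv_weak_derivative s psi : 0 <= s ->
  \int[leb]_x (rc s x * derive1 psi x) = \int[leb]_v (kt v * (psi (s - v) - psi (- v))).
Proof.
move=> s0.
pose H (p : R * R) := \1_(`[0, s[ : set R) (p.2 + p.1) * kt p.2 * derive1 psi p.1.
have mH : measurable_fun setT H.
  apply: measurable_funM; last first.
    apply: measurableT_comp => //.
    exact: (measurable_schwartz (derive_schwartz psi)).
  apply: measurable_funM.
    by apply: measurableT_comp => //; exact: measurable_funD.
  by apply: measurableT_comp => //; exact: measurable_zero_ext.
have inner1 (g : R -> R) x :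
    (\int[leb]_v (\1_(`[0, s[ : set R) (v + x)%R * kt v * g x)%:E = (rc s x * g x)%:E)%E.
  have ii := integrable_right_conv k_noninc k_int s x.
  rewrite right_convE// -RintegralZr// /Rintegral fineK//.
  apply: integrable_fin_num => //.
  apply: eq_integrable (integrableZl measurableT (g x) ii) => // v _ /=.
  by rewrite -EFinM mulrC.
have inner2 v : (\int[leb]_x (H (x, v))%:E = (kt v * (psi (s - v) - psi (- v)))%:E)%E.
  rewrite EFinM -integral_derive_schwartz; last by lra.
  rewrite -integralZl//; last first.
    by apply: integrableS (integrable_schwartz (derive_schwartz psi)).
  rewrite [RHS]integral_mkcond; apply: eq_integral => x _.
  rewrite patchE mem_setE in_itv/= /H/= indic_itvE.
  have -> : (- v <= x < s - v) = (0 <= v + x < s).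
    by congr andb; apply/idP/idP => ?; lra.
  by case: ifP => _; rewrite ?mul1r// !mul0r.
(* All factors but the derivative are nonnegative, so integrating the absolute value in [v] returns
   [rc s x] times the absolute value of [derive1 psi x], which is integrable. *)
have Hi : (leb \x leb)%E.-integrable setT (EFin \o H).
  apply/integrable12ltyP; first exact/measurable_EFinP.
  have /integrableP[_] := integrable_right_convM s (derive_schwartz psi).
  apply: le_lt_trans; rewrite le_eqVlt; apply/orP; left; apply/eqP.
  apply: eq_integral => x _ /=.
  transitivity (rc s x * `|derive1 psi x|)%:E; last first.
    by rewrite normrM (ger0_norm (right_conv_ge0 _ _ _ _)).
  rewrite -(inner1 (fun x => `|derive1 psi x|)); apply: eq_integral => v _ /=.
  rewrite /H/= normrM (ger0_norm (x := _ * _))// mulr_ge0//.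
  exact: zero_ext_ge0.
rewrite /Rintegral; congr fine.
under eq_integral do rewrite -inner1.
under [in RHS]eq_integral do rewrite -inner2.
exact: (Fubini Hi).
Qed.

(** The two terms are integrable separately, so the first alone can be translated by [s]; this moves
    the increment from [psi] to the kernel. *)
Lemma right_conv_increment s psi : 0 <= s ->
  \int[leb]_x (rc s x * derive1 psi x) = \int[leb]_u ((kt (u + s) - kt u) * psi (- u)).
Proof.
move=> s0; rewrite right_conv_weak_derivative//.
have [B B0 psiB] := bounded_schwartz psi.
have opsi := integrable_opp (integrable_schwartz psi).
have i0 : leb.-integrable setT (EFin \o (fun v => kt v * psi (- v))).
  by apply: (integrable_zero_extM (B := B)) => // v; exact: psiB.
have i1 : leb.-integrable setT (EFin \o (fun v => kt v * psi (s - v))).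
  apply: (integrable_zero_extM (B := B)) => [v|]; first exact: psiB.
  have := integrable_shift (- s) opsi; congr (_.-integrable _ _).
  by apply/funext => v /=; rewrite opprD opprK addrC.
have i2 := integrable_shift s i1.
transitivity (\int[leb]_v (kt v * psi (s - v)) - \int[leb]_v (kt v * psi (- v))).
  by rewrite -RintegralB//; apply: eq_Rintegral => v _; rewrite mulrBr.
rewrite -(Rintegral_shift s i1) -RintegralB//; apply: eq_Rintegral => u _.
have -> : s - (u + s) = - u by ring.
by rewrite mulrBl.
Qed.

(** [m] controls the increments of [k] beyond 1; for the Levy tail it is the Levy density cut off to
    []1, +oo[]. *)
Variable m : R -> R.
Hypothesis m_sq : sq_integrable leb m.
Hypothesis k_sq : leb.-integrable `]0, 1[ (EFin \o (fun x => k x ^+ 2)).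
Hypothesis k_incr : forall u s, 1 < u -> 0 <= s -> k u - k (u + s) <= s * m u.

(** The cutoff is at [1 + t] because [u <= 1] and [s <= t] give [u + s <= 1 + t]. *)
Let q t : R -> R := (fun x => k x ^+ 2) \_ `]0, 1 + t].

Let q_ge0 t x : 0 <= q t x.
Proof. by rewrite /q patchE; case: ifP => // _; exact: sqr_ge0. Qed.

Let integrable_q t : 0 <= t -> leb.-integrable setT (EFin \o q t).
Proof.
move=> t0.
have i1 := integrable_patch (measurable_itv `]0, 1[) k_sq.
have i2 := integrableZl measurableT (k 1 ^+ 2)
  (integrable_indic_itv 1 (1 + t) true false).
apply: (le_integrable measurableT _ _ (integrableD measurableT i1 i2)).
  apply/measurable_EFinP; apply/(measurable_restrictT _ _).1 => //.
  apply: measurable_funX; apply: measurable_funS (measurable_noninc k_noninc) => //.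
  by apply: subset_itvl; rewrite bnd_simp.
move=> x _ /=; rewrite lee_fin ger0_norm// /q !patchE indicE !mem_setE !in_itv/=.
have [x0|x0] := ltP 0 x; last by rewrite normr_ge0.
have [x1|x1] /= := ltP x 1.
  rewrite mulr0 addr0 ger0_norm ?sqr_ge0//.
  by case: ifP => // _; exact: sqr_ge0.
have [xt|xt] /= := leP x (1 + t); last by rewrite normr_ge0.
have k10 : 0 <= k 1 by exact: k_ge0.
have kx0 : 0 <= k x by exact: k_ge0.
rewrite add0r mulr1 ger0_norm ?sqr_ge0// ler_pXn2r ?nnegrE//.
exact: k_noninc.
Qed.

(** For [u > 1] the increment is at most [s * m u]. For [u <= 1] both values of the kernel lie in
    the range of [q t], and the squared difference of two nonnegative numbers is at most the sum of
    their squares. *)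
Let incr_le s t u : 0 <= s <= t ->
  (kt (u + s) - kt u) ^+ 2 <= q t (u + s) + q t u + t ^+ 2 * m u ^+ 2.
Proof.
move=> /andP[s0 st].
have [u1|u1] := ltP 1 u.
  apply: (@le_trans _ _ (t ^+ 2 * m u ^+ 2)); last first.
    by rewrite lerDr addr_ge0.
  have u0 : 0 < u by exact: lt_trans u1.
  have us0 : 0 < u + s by rewrite ltr_wpDr.
  rewrite /zero_ext u0 us0 -exprMn -sqrrN opprB.
  have d0 : 0 <= k u - k (u + s) by rewrite subr_ge0 k_noninc// lerDl.
  have d1 := k_incr u1 s0.
  apply: (@le_trans _ _ ((s * m u) ^+ 2)).
    by rewrite ler_pXn2r// nnegrE//; exact: le_trans d1.
  by rewrite !exprMn ler_wpM2r ?sqr_ge0// ler_pXn2r// nnegrE//; exact: le_trans st.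
apply: (@le_trans _ _ (q t (u + s) + q t u)); last first.
  by rewrite lerDl mulr_ge0 ?sqr_ge0.
have qE v : v <= 1 + t -> q t v = kt v ^+ 2.
  move=> vt; rewrite /q /zero_ext patchE mem_setE in_itv/= vt andbT.
  by case: ifP => // _; rewrite expr0n.
rewrite !qE; [|lra|lra].
have := zero_ext_ge0 k_ge0 u; have := zero_ext_ge0 k_ge0 (u + s); nra.
Qed.

Lemma right_conv_weak_bound t : 0 <= t -> exists C, forall s, 0 <= s <= t ->
  forall psi, (\int[leb]_x (rc s x * derive1 psi x)) ^+ 2 <= C * ip psi psi.
Proof.
move=> t0.
have qi := integrable_q t0.
have mi := integrableZl measurableT (t ^+ 2) m_sq.2.
(* This is the integral of the bound in [incr_le]; the shifted term integrates like [q t] itself, so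
   the constant does not depend on [s]. *)
exists (\int[leb]_x q t x + \int[leb]_x q t x + t ^+ 2 * \int[leb]_x (m x ^+ 2)).
move=> s /[dup] st /andP[s0 _] psi; rewrite right_conv_increment//.
have qsi := integrable_shift s qi.
pose D u := kt (u + s) - kt u.
have mD : measurable_fun setT D.
  apply: measurable_funB; last exact: measurable_zero_ext.
  by apply: measurable_shift; exact: measurable_zero_ext.
have Di : sq_integrable leb D.
  split=> //; apply: (le_integrable measurableT _ _
    (integrableD measurableT (integrableD measurableT qsi qi) mi)).
    by apply/measurable_EFinP; exact: measurable_funX.
  move=> u _ /=; rewrite lee_fin ger0_norm ?sqr_ge0//.
  by apply: le_trans (ler_norm _); exact: incr_le.
have opsi : sq_integrable leb (fun u => psi (- u)).
  split; first by apply: (measurableT_comp (measurable_schwartz psi)).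
  exact: (integrable_opp (f := fun x => psi x ^+ 2) (sq_integrable_schwartz psi).2).
apply: (le_trans (cauchy_schwarz Di opsi)).
have -> : \int[leb]_u (psi (- u) ^+ 2) = ip psi psi.
  rewrite /ip /Rintegral; congr fine.
  rewrite (ge0_integral_opp (f := fun x => (psi x ^+ 2)%:E)).
  - by apply: eq_integral => x _; rewrite expr2.
  - by apply/measurable_EFinP; apply: measurable_funX; exact: measurable_schwartz.
  - by move=> x; rewrite lee_fin sqr_ge0.
apply: ler_wpM2r; first exact: ip_ge0.
rewrite -{1}(Rintegral_shift s qi) -RintegralZl//; last exact: m_sq.2.
rewrite -!RintegralD//; last exact: (integrableD measurableT qsi qi).
apply: le_Rintegral => //.
- exact: Di.2.
- exact: (integrableD measurableT (integrableD measurableT qsi qi) mi).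
- by move=> u _; exact: incr_le.
Qed.

End WeakDerivative.

(** * The Levy tail satisfies the hypotheses on the kernel *)

Section LevyTail.
Variable R : realType.
Notation leb := (@lebesgue_measure R).
Variable nubar : R -> R.
Hypothesis cm : completely_monotone nubar.
Hypothesis ld : levy_density nubar.

Lemma levy_density_ge0 x : 0 < x -> 0 <= nubar x.
Proof. by move=> x0; have [_] := cm 0%N x0; rewrite expr0 mul1r. Qed.

Lemma levy_density_noninc x y : 0 < x -> x <= y -> nubar y <= nubar x.
Proof.
move=> x0 xy.
have d z : 0 < z -> derivable nubar z 1 by move=> z0; have [] := cm 0%N z0.
have gt0 z : z \in `[x, y] -> 0 < z.
  by rewrite in_itv/= => /andP[xz _]; exact: lt_le_trans xz.
apply: (@ler0_derive1_nincr R nubar x y) => //.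
- by move=> z zxy; apply: d; apply: gt0; exact: subset_itv_oo_cc.
- move=> z zxy; have z0 : 0 < z by apply: gt0; exact: subset_itv_oo_cc.
  by have [_] := cm 1%N z0; rewrite expr1 mulN1r oppr_ge0.
- apply: derivable_within_continuous => z zxy; apply: d; exact: gt0.
Qed.

Lemma integrable_levy_density x : 0 < x -> leb.-integrable `]x, +oo[ (EFin \o nubar).
Proof.
move=> x0; case: ld => mn fin.
have sub : `]x, +oo[ `<=` (`]0, +oo[ : set R).
  by apply: subset_itvr; rewrite bnd_simp ltW.
(* On []x, +oo[] one has [c <= Num.min s 1], so the density is at most [c^-1] times the integrand of
   the Levy condition. *)
pose c := Num.min x 1; have c0 : 0 < c by rewrite lt_min x0 ltr01.
have gi : leb.-integrable `]0, +oo[ (EFin \o (fun s => Num.min s 1 * nubar s)).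
  apply/integrableP; split.
    apply/measurable_EFinP; apply: measurable_funM => //.
    exact: measurable_minr.
  move: fin; apply: le_lt_trans; rewrite le_eqVlt; apply/orP; left; apply/eqP.
  apply: eq_integral => s.
  rewrite inE/= in_itv/= andbT => s0 /=; rewrite ger0_norm// mulr_ge0//.
    by rewrite le_min ltW//= ler01.
  exact: levy_density_ge0.
have gix : leb.-integrable `]x, +oo[ (EFin \o (fun s => Num.min s 1 * nubar s)).
  by apply: integrableS gi.
apply: (le_integrable _ _ _ (integrableZl _ c^-1 gix)) => //.
  by apply/measurable_EFinP; apply: measurable_funS mn.
move=> s /=; rewrite in_itv/= andbT => xs; rewrite lee_fin !normrM.
have s0 : 0 < s by exact: lt_trans xs.
rewrite mulrA ler_peMl// normfV (gtr0_norm c0) mulrC ler_pdivlMr// mul1r.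
rewrite ger0_norm; last by rewrite le_min ltW//= ler01.
by rewrite /c le_min !ge_min (ltW xs) lexx orbT.
Qed.

Lemma levy_tailE x : 0 < x -> levy_tail nubar x = \int[leb]_(z in `]x, +oo[) nubar z.
Proof. by rewrite /levy_tail => ->. Qed.

Lemma levy_tail_ge0 x : 0 < x -> 0 <= levy_tail nubar x.
Proof.
move=> x0; rewrite levy_tailE//; apply: Rintegral_ge0 => z /=.
by rewrite in_itv/= andbT => xz; apply: levy_density_ge0; exact: lt_trans xz.
Qed.

Lemma levy_tail_increment u s : 0 < u -> 0 <= s ->
  levy_tail nubar u - levy_tail nubar (u + s) = \int[leb]_(z in `]u, u + s]) nubar z.
Proof.
move=> u0 s0; have us : 0 < u + s by rewrite ltr_wpDr.
rewrite !levy_tailE//.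
have := @Rintegral_itvB R nubar (BRight u) +oo%O (u + s) (integrable_levy_density u0).
by rewrite !bnd_simp lerDl => /(_ s0 isT) <-; ring.
Qed.

Lemma levy_tail_noninc x y : 0 < x -> x <= y -> levy_tail nubar y <= levy_tail nubar x.
Proof.
move=> x0 xy; rewrite -subr_ge0.
have yx : 0 <= y - x by rewrite subr_ge0.
have := levy_tail_increment x0 yx; rewrite addrCA subrr addr0 => ->.
apply: Rintegral_ge0 => z /=.
by rewrite in_itv/= => /andP[xz _]; apply: levy_density_ge0; exact: lt_trans xz.
Qed.

(** The increment is the integral of the density over []u, u + s]], where the density is at most its
    value at [u]. *)
Lemma levy_tail_increment_le u s : 0 < u -> 0 <= s ->
  levy_tail nubar u - levy_tail nubar (u + s) <= s * nubar u.
Proof.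
move=> u0 s0; rewrite levy_tail_increment//.
have finI : (leb `]u, (u + s)%R]%classic < +oo)%E.
  by rewrite lebesgue_measure_itv/=; case: ifP => // _; rewrite -EFinB ltry.
have -> : s * nubar u = \int[leb]_(z in `]u, u + s]) nubar u.
  rewrite Rintegral_cst//= lebesgue_measure_itv/= lte_fin ltrDl mulrC.
  move: s0; rewrite le_eqVlt => /predU1P[<-|s0]; first by rewrite ltxx.
  by rewrite s0/= addrAC subrr add0r.
apply: le_Rintegral => //.
- by apply: integrableS (integrable_levy_density u0) => //; exact: subset_itvl.
- apply: measurable_bounded_integrable => //.
  exists `|nubar u|; split; first exact: num_real.
  by move=> M uM z _; exact: ltW.
- move=> z /=; rewrite in_itv/= => /andP[uz _].
  by apply: levy_density_noninc => //; exact: ltW.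
Qed.

Hypothesis A2 : condA2 (levy_tail nubar).
Hypothesis A1 : condA1 nubar.

Lemma levy_tail_sq : leb.-integrable `]0, 1[ (EFin \o (fun x => levy_tail nubar x ^+ 2)).
Proof.
have [_ H] := Lp_on2_sq_integrable (measurable_itv `]0, 1[) A2.1.
apply: integrable_unpatch => //; move: H; congr (_.-integrable _ _).
by apply/funext => x /=; rewrite !patchE; case: ifP => // _; rewrite expr0n.
Qed.

(** On []0, 1[] the tail [k] satisfies [k <= k ^+ 2 + 1], and from 1 on it is at most [k 1]; the
    constant [1 + k 1] covers both cases. *)
Lemma integrable_levy_tail a : 0 < a -> leb.-integrable `]0, a] (EFin \o levy_tail nubar).
Proof.
move=> a0; have i1 := integrable_patch (measurable_itv `]0, 1[) levy_tail_sq.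
set k := levy_tail nubar; have k10 : 0 <= k 1 by exact: levy_tail_ge0.
have i2 := integrable_indic_itv 0 a false false.
have i3 := integrableZl measurableT (1 + k 1) i2.
apply: integrable_unpatch => //.
have mk : measurable_fun setT (k \_ `]0, a]).
  apply/(measurable_restrictT _ _).1 => //.
  apply: measurable_funS (measurable_noninc levy_tail_noninc) => //.
  by apply: subset_itvl; rewrite bnd_simp.
apply: (le_integrable measurableT _ _ (integrableD measurableT i1 i3)).
  exact/measurable_EFinP.
move=> x _ /=; rewrite lee_fin !patchE indicE !mem_setE !in_itv/=.
have [x0|x0] /= := ltP 0 x; last by rewrite normr0.
have [xa|xa] /= := leP x a; last by rewrite normr0.
rewrite mulr1 ger0_norm; last exact: levy_tail_ge0.
apply: le_trans (ler_norm _); have kx := levy_tail_ge0 x0; rewrite -/k in kx *.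
have [x1|x1] := ltP x 1; first by nra.
by have := levy_tail_noninc ltr01 x1; rewrite -/k add0r; lra.
Qed.

Lemma levy_tail_weak_bound t : 0 <= t -> exists C, forall s, 0 <= s <= t ->
  forall psi : schwartz R,
    (\int[leb]_x (right_conv (levy_tail nubar) \1_(`[0, s[) x * derive1 psi x)) ^+ 2
    <= C * ip psi psi.
Proof.
move=> t0; apply: (right_conv_weak_bound levy_tail_ge0 levy_tail_noninc
  integrable_levy_tail (Lp_on2_sq_integrable (measurable_itv `]1, +oo[) A1)) => //.
- exact: levy_tail_sq.
- move=> u s u1 s0; rewrite patchE mem_setE in_itv/= u1/=.
  by apply: levy_tail_increment_le => //; exact: lt_trans u1.
Qed.

End LevyTail.

(** * Local boundedness and measurability of the noise family for both kernels *)

Section NoiseFamily.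
Variable R : realType.
Notation leb := (@lebesgue_measure R).
Variable h : R -> R -> R.

(** The functions themselves satisfy [0 <= h s x <= h t x] for [0 <= s <= t], so the squared norm of
    [h t] serves all smaller [s], and the monotone family is [h] with weight [psi]. *)
Lemma M_kappa_regular kappa phi :
  (forall t, 0 <= t -> sq_integrable leb (h t)) -> sonine_associate phi kappa ->
  (forall t, 0 <= t -> h t = M_kappa kappa t) ->
  (forall t, 0 <= t ->
     exists C, forall s, 0 <= s <= t -> L2_bounded C (L2_form (h s))) /\
  (forall t (psi : schwartz R), 0 <= t ->
     measurable_fun (`[0, t] : set R) (fun s => L2_form (h s) psi)).
Proof.
move=> h_sq [k0 kd ki _] hE.
have hmono s s' x : 0 <= s -> s <= s' -> 0 <= h s x <= h s' x.
  move=> s0 ss'; have s'0 := le_trans s0 ss'; rewrite !hE// /M_kappa.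
  rewrite mulr_ge0 ?sqrtr_ge0 ?right_conv_ge0//= ler_wpM2l ?sqrtr_ge0//.
  exact: right_conv_nondecr.
split=> [t t0|t psi t0].
  exists (\int[leb]_x (h t x ^+ 2)) => s /andP[s0 st] psi.
  apply: le_trans (L2_bounded_L2_form (h_sq s s0) psi) _.
  rewrite ler_wpM2r ?ip_ge0//; apply: le_Rintegral => //.
  - exact: (h_sq s s0).2.
  - exact: (h_sq t t0).2.
  - move=> x _; have /andP[h0 hh] := hmono s t x s0 st.
    by rewrite ler_pXn2r ?nnegrE//; exact: le_trans hh.
apply: measurable_monotone_family => //.
- by move=> s s0; exact: (h_sq s s0).1.
- exact: measurable_schwartz.
- by move=> s s0; apply: integrable_L2_form; exact: h_sq.
Qed.

(** Each [h t] is determined only through its pairing with test functions, so monotonicity is not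
    read off [h]; both claims are transferred to [right_conv] tested against [derive1 psi]. *)
Lemma M_nu_regular nubar : completely_monotone nubar -> levy_density nubar ->
  condA1 nubar -> condA2 (levy_tail nubar) ->
  (forall t, 0 <= t -> M_nu (levy_tail nubar) t (h t)) ->
  (forall t, 0 <= t ->
     exists C, forall s, 0 <= s <= t -> L2_bounded C (L2_form (h s))) /\
  (forall t (psi : schwartz R), 0 <= t ->
     measurable_fun (`[0, t] : set R) (fun s => L2_form (h s) psi)).
Proof.
move=> cm ld A1 A2 hM.
set c := Num.sqrt (norm_const (levy_tail nubar)).
have hE s psi : 0 <= s -> L2_form (h s) psi = c *
    \int[leb]_x (right_conv (levy_tail nubar) \1_(`[0, s[) x * derive1 psi x).
  move=> s0; have [g [g2 gw ->]] := hM s s0.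
  have gsq : sq_integrable leb g.
    by have := Lp_on2_sq_integrable measurableT g2; rewrite patch_setT.
  rewrite -gw -RintegralZl//; last exact: integrable_L2_form.
  by apply: eq_Rintegral => x _; rewrite mulrA.
split=> [t t0|t psi t0].
  have [C HC] := levy_tail_weak_bound cm ld A2 A1 t0.
  exists (c ^+ 2 * C) => s /[dup] st /andP[s0 _] psi.
  rewrite hE// exprMn -[leRHS]mulrA.
  by apply: ler_wpM2l; [exact: sqr_ge0|exact: HC].
have k0 := levy_tail_ge0 cm.
have kd := levy_tail_noninc cm ld.
have ki := integrable_levy_tail cm ld A2.
have : measurable_fun (`[0, t] : set R) (fun s => c *
    \int[leb]_x (right_conv (levy_tail nubar) \1_(`[0, s[) x * derive1 psi x)).
  apply: measurable_funM => //; apply: measurable_monotone_family => //.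
  - by move=> s _; exact: measurable_right_conv.
  - exact: (measurable_schwartz (derive_schwartz psi)).
  - by move=> s _; exact: (integrable_right_convM k0 kd ki s (derive_schwartz psi)).
  - move=> s s' x s0 ss'; rewrite right_conv_ge0//=; exact: right_conv_nondecr.
apply: eq_measurable_fun => s; rewrite inE/= in_itv/= => /andP[s0 _].
by rewrite hE.
Qed.

End NoiseFamily.
Unset Implicit Arguments.

(** * Assembly of the solution from the regularity of the noise *)

Theorem mainTheorem4 (R : realType) (phi nubar : R -> R)
    (phiB : complete_bernstein phi nubar) (phiC : condC phi) (phiK : condK phi)
    (mu : probability (wn_space R) R) (muW : white_noise mu)
    (* h t is M_-^(phi) 1_[0,t) *)
    (h : R -> R -> R)
    (hM : [/\ condA1 nubar, condA2 (levy_tail nubar) &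
              forall t : R, 0 <= t -> M_nu (levy_tail nubar) t (h t)] \/
          (exists kappa : R -> R,
            [/\ sonine_associate phi kappa, condB1 kappa,
                condB2 (sonine_primitive kappa) &
                forall t : R, 0 <= t -> h t = M_kappa kappa t]))
    (* X t is a version of X_phi(1_[0,t)) = <w, M_-^(phi) 1_[0,t)> *)
    (X : R -> wn_space R -> R)
    (hX : forall t : R, 0 <= t -> wn_pairing mu (h t) (X t))
    (theta sigma u0 : R) (theta_gt0 : 0 < theta) :
  (* Xi t is X t seen in (S)^{-1}; J t is int_0^t e^{theta(s-t)} X s ds *)
  exists Xi J : R -> chaos R,
    [/\ forall t : R, 0 <= t -> S1 (Xi t) /\ chaos_decomposition mu (X t) (Xi t),
        forall t : R, 0 <= t ->
          S1_integral t (fun s => chaos_scale (expR (theta * (s - t))) (Xi s)) (J t) &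
        let U := fun t : R =>
          chaos_add (chaos_const (u0 * expR (- (theta * t))))
            (chaos_add (chaos_scale sigma (Xi t))
                       (chaos_scale (- (sigma * theta)) (J t))) in
        forall t : R, 0 <= t ->
          S1 (U t) /\
          exists2 I : chaos R, S1_integral t U I &
            U t = chaos_add (chaos_const u0)
                    (chaos_add (chaos_scale (- theta) I)
                               (chaos_scale sigma (Xi t)))].
Proof.
have h_sq t : 0 <= t -> sq_integrable (leb R) (h t).
  by move=> t0; exact: wn_pairing_sq_integrable (hX t t0).
(* The two choices of operator are treated separately only here; what follows uses the common
   conclusion. *)
have [bnd meas] :
    (forall t, 0 <= t ->
       exists C, forall s, 0 <= s <= t -> L2_bounded C (L2_form (h s))) /\
    (forall t (psi : schwartz R), 0 <= t ->
       measurable_fun (`[0, t] : set R) (fun s => L2_form (h s) psi)).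
  case: phiB => cm ld _ _; case: hM => [[A1 A2 hM]|[kappa [kS _ _ hM]]].
  - exact: (M_nu_regular cm ld A1 A2 hM).
  - exact: (M_kappa_regular h_sq kS hM).
have lin t : 0 <= t -> linear_form (L2_form (h t)).
  by move=> t0; apply: linear_L2_form; exact: h_sq.
have [J [S1Xi [intJ solU]]] := OU_solution sigma u0 theta_gt0 lin bnd meas.
exists (fun t => affine_chaos 0 (L2_form (h t))), J; split=> // t t0.
by split; [exact: S1Xi|exact: chaos_decomposition_pairing (hX t t0)].
Qed.
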